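(* (i) Let $d\ge3$. For all real $p,n$ with $p\ge n>d/2$ one has $K_{pn}\ge K^{\langle-\rangle}_{pn}$, where $$K^{\langle-\rangle}_{pn}:=\frac1{(2\pi)^{d/2}}\Big(\frac{n+1}p\Big)^{(n+1)/2}\frac{\Theta_{pn}^{1/2}\cdot2^{p+n/2+1}}{\Phi_{pn}^{p/2}\Psi_{pn}^{n/2+1/2}+\Phi_{pn}^{n/2}\Psi_{pn}^{p/2+1/2}},$$ $$\Theta_{pn}:=\Big(1-\frac{n-1}{2p}\Big)^p+\Big(\frac{n+1}{2p}\Big)^p,$$ $$\Phi_{pn}:=1+2\sqrt{1-\frac np}\sqrt{\frac{2(n+1)}p}+\frac{n+2}p,\qquad\Psi_{pn}:=1+2\sqrt{1-\frac np}\sqrt{\frac{2(n+1)}p}+\frac{3n+4}p.$$ (ii) Let $d=2$. For all real $p,n$ with $p\ge n>1$ one has $K_{pn}\ge K^{\langle-\rangle}_{pn}$, where $$K^{\langle-\rangle}_{pn}:=\frac1\pi\Big(\frac{n+1}p\Big)^{(n+1)/2}\frac{\Theta_{pn}^{1/2}\cdot2^{p+n/2}}{\Phi_{pn}^{p/2}\Psi_{pn}^{n/2+1}+\Phi_{pn}^{n/2}\Psi_{pn}^{p/2+1}},$$ $$\Theta_{pn}:=\Big(1+\frac3p\Big)^2\Big(1-\frac{n-5}{2p}\Big)^{p-1}+4\Big(\frac{n+1}{2p}\Big)^{p+1},$$ $$\Phi_{pn}:=1+2\sqrt{1-\frac{n-2}p}\sqrt{\frac{2(n+1)}p}+\frac{n+4}p,\qquad\Psi_{pn}:=1+2\sqrt{1-\frac{n-2}p}\sqrt{\frac{2(n+1)}p}+\frac{3(n+2)}p.$$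 (iii) Let $d\ge2$, and let $K^{\langle-\rangle}_{pn}$ be defined as in (i) if $d\ge3$ and as in (ii) if $d=2$. For fixed $n>d/2$ and $p\to+\infty$ one has $$K^{\langle-\rangle}_{pn}\sim\frac2{(2\pi)^{d/2}}\,\frac{e^{5(n+1)/4}}{e^{n+1}+1}\Big(\frac{n+1}p\Big)^{(n+1)/2}\frac{2^{p+n/2}}{e^{\sqrt{2(n+1)p}}}$$ and $(K^{\langle-\rangle}_{pn})^{1/p}\to2$.
   Context: Notation. $\mathbf T^d=(\mathbf R/2\pi\mathbf Z)^d$; $e_k(x)=(2\pi)^{-d/2}e^{ik\cdot x}$ for $k\in\mathbf Z^d$; $a\cdot b=\sum_ra_rb_r$ and $|a|=\sqrt{\overline a\cdot a}$ on $\mathbf C^d$; $\mathbf Z^d_0=\mathbf Z^d\setminus\{0\}$. An $\mathbf R^d$-valued distribution on $\mathbf T^d$ has a Fourier expansion $v=\sum_kv_ke_k$, $v_k=\overline{v_{-k}}\in\mathbf C^d$. For real $m$, $\mathbb H^m$ is the space of such $v$ with $k\cdot v_k=0$ for all $k$, $v_0=0$ and $\|v\|_m^2:=\sum_{k\in\mathbf Z^d_0}|k|^{2m}|v_k|^2<\infty$. The Leray projection $\mathfrak L$ acts by $(\mathfrak Lv)_k=v_k-\frac{k\cdot v_k}{|k|^2}k$ for $k\ne0$, $(\mathfrak Lv)_0=v_0$. $\mathcal P(v,w)=\mathfrak L(v\cdot\partial w)$, $(v\cdot\partial w)_s=\sum_{r=1}^dv_r\partial_rw_s$; for $p>d/2$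 it maps $\mathbb H^p\times\mathbb H^{p+1}$ to $\mathbb H^p$. For $p\ge n>d/2$, $K_{pn}$ is the sharp (i.e. minimum) constant $K$ such that $\|\mathcal P(v,w)\|_p\le\frac12K(\|v\|_p\|w\|_{n+1}+\|v\|_n\|w\|_{p+1})$ for all $v\in\mathbb H^p$, $w\in\mathbb H^{p+1}$ (such constants exist). $f(p)\sim g(p)$ means $f(p)/g(p)\to1$. *)

(* Defs.v *)
From HB Require Import structures.
From mathcomp Require Import all_boot all_order all_algebra.
From mathcomp Require Import complex.
From mathcomp Require Import all_classical all_reals all_analysis.
Set Implicit Arguments.
Unset Strict Implicit.
Unset Printing Implicit Defensive.
Import Order.TTheory GRing.Theory Num.Theory.
Import numFieldNormedType.Exports.
Local Open Scope classical_set_scope.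
Local Open Scope ring_scope.
Local Open Scope complex_scope.

Section FourierSeries.
Variables (R : realType) (d : nat).
Local Notation C := R[i].
Implicit Types (k : 'rV[int]_d) (x : 'rV[R]_d) (a b : 'rV[C]_d) (m : R).

(* a . b, bilinear: no conjugation *)
Definition cdot a b : C := \sum_r a 0 r * b 0 r.

Definition cnorm a : R := Num.sqrt (complex.Re (cdot (map_mx conjc a) a)).

Definition zvec k : 'rV[C]_d := map_mx intr k.

Definition torus_char k x : C :=
  let t := \sum_r (k 0 r)%:~R * x 0 r in
  ((2 * pi) `^ (- (d%:R / 2)))%:C * (cos t +i* sin t).

(* A distribution v on T^d is given by the family k |-> v_k of its Fourier
   coefficients: the families arising in this way are those of at most
   polynomial growth, and v is R^d-valued when v_k and v_(-k) are conjugate. *)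
Definition coefs := 'rV[int]_d -> 'rV[C]_d.

Definition torus_distribution (v : coefs) : Prop :=
  (forall k, v k = map_mx conjc (v (- k))) /\
  exists c N : R, forall k, cnorm (v k) <= c * (1 + cnorm (zvec k)) `^ N.

(* The norm || ||_m, with value +oo when the series diverges. *)
Definition hnorm m (v : coefs) : \bar R :=
  ((\esum_(k in [set k | k != 0%R])
      (cnorm (zvec k) `^ (2 * m) * cnorm (v k) ^+ 2)%:E) `^ 2^-1)%E.

Definition hspace m : set coefs :=
  [set v | [/\ torus_distribution v, forall k, cdot (zvec k) (v k) = 0,
               v 0 = 0 & (hnorm m v < +oo)%E]].

Definition leray (v : coefs) : coefs := fun k =>
  if k == 0 then v k
  else v k - (cdot (zvec k) (v k) / (cnorm (zvec k) ^+ 2)%:C) *: zvec k.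

Definition partial_deriv (r : 'I_d) (v : coefs) : coefs :=
  fun k => ('i * (k 0 r)%:~R) *: v k.

(* The function sum_k v_k e_k, as the limit of the partial sums over the cubes
   max_r |k_r| <= N. The series converges absolutely for v in H^m, m > d/2,
   and for the partial derivatives of such a v when m > d/2 + 1. *)
Definition fun_of_coefs (v : coefs) x : 'rV[C]_d :=
  \row_s lim ((\sum_(k \in [set k : 'rV[int]_d | forall r, `|k 0 r| <= N%:Z])
                 v k 0 s * torus_char k x : C^o) @[N --> \oo]).

End FourierSeries.

(* Integration over T^d, identified with [0, 2pi]^d, as an iterated Lebesgue
   integral; it is only applied to continuous functions. *)
Fixpoint torus_integral (R : realType) (d : nat) :
    ('rV[R]_d -> R) -> R :=
  match d with
  | 0 => fun f => f 0
  | d'.+1 => fun f =>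
      \int[lebesgue_measure]_(t in `[0, 2 * pi])
        torus_integral (fun y : 'rV[R]_d' => f (row_mx (t%:M : 'rV[R]_1) y))
  end.

Section SharpConstant.
Variables (R : realType) (d : nat).
Local Notation C := R[i].

Definition fourier_coefs (f : 'rV[R]_d -> 'rV[C]_d) : coefs R d := fun k =>
  \row_s (torus_integral (fun x => complex.Re (f x 0 s * (torus_char k x)^*)) +i*
          torus_integral (fun x => complex.Im (f x 0 s * (torus_char k x)^*))).

(* v . dw; the products v_r d_r w_s are pointwise products of functions *)
Definition advection (v w : coefs R d) : coefs R d :=
  fourier_coefs (fun x => \row_s \sum_r
    fun_of_coefs v x 0 r * fun_of_coefs (partial_deriv r w) x 0 s).

Definition proj_advection (v w : coefs R d) : coefs R d :=
  leray (advection v w).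

Definition admissible (p n K : R) : Prop :=
  forall v w : coefs R d, hspace p v -> hspace (p + 1) w ->
  (hnorm p (proj_advection v w) <=
   (2^-1 * K)%:E * (hnorm p v * hnorm (n + 1) w
                  + hnorm n v * hnorm (p + 1) w))%E.

(* K_pn; it is +oo if there is no admissible constant, and see
   sharp_constantP below: a real value of it is a minimum. *)
Definition sharp_constant (p n : R) : \bar R :=
  ereal_inf [set K%:E | K in admissible p n].

Lemma cnorm_zvec_ge1 (k : 'rV[int]_d) : k != 0 -> 1 <= cnorm (zvec R k).
Proof.
move=> /rV0Pn[r kr0]; rewrite /cnorm -(sqrtr1 R) ler_wsqrtr//.
have -> : complex.Re (cdot (map_mx conjc (zvec R k)) (zvec R k)) =
    (\sum_s (k 0 s) ^+ 2)%:~R.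
  rewrite /cdot raddf_sum rmorph_sum /=; apply: eq_bigr => s _.
  rewrite !mxE.
  have -> : (k 0 s)%:~R = ((k 0 s)%:~R : R)%:C :> R[i] by rewrite rmorph_int.
  by rewrite conjc_real -rmorphM /= -intrM -expr2.
rewrite ler1z (bigD1 r)//= -[leLHS]addr0 lerD ?sumr_ge0// => [|s _].
  by rewrite -gtz0_ge1 exprn_even_gt0.
exact: sqr_ge0.
Qed.

Lemma hnorm_lty (m m' : R) (v : coefs R d) :
  m <= m' -> (hnorm m' v < +oo)%E -> (hnorm m v < +oo)%E.
Proof.
move=> mm' /lty_poweRy v_fin; apply: poweR_lty.
apply: le_lt_trans (v_fin _); last by rewrite gt_eqF.
apply: le_esum => k /= k0; rewrite lee_fin ler_wpM2r ?sqr_ge0//.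
by rewrite ler_powR ?cnorm_zvec_ge1// ler_wpM2l.
Qed.

Lemma sharp_constantP (p n K : R) : n <= p ->
  sharp_constant p n = K%:E <->
  admissible p n K /\ forall K', admissible p n K' -> K <= K'.
Proof.
move=> np; split=> [KE|[admK minK]]; last first.
  apply/le_anti/andP; split; first by apply: ereal_inf_lbound; exists K.
  by apply: le_ereal_inf_tmp => _ [K' admK' <-]; rewrite lee_fin minK.
split=> [v w Hv Hw|K' admK']; last first.
  by rewrite -lee_fin -KE; apply: ereal_inf_lbound; exists K'.
have [vp wp] : ((hnorm p v < +oo) /\ (hnorm (p + 1) w < +oo))%E.
  by case: Hv => _ _ _ ?; case: Hw.
have vn := hnorm_lty np vp.
have wn : (hnorm (n + 1) w < +oo)%E by apply: hnorm_lty wp; rewrite lerD2r.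
set X := (hnorm p v * hnorm (n + 1) w + hnorm n v * hnorm (p + 1) w)%E.
have X0 : (0 <= X)%E by rewrite adde_ge0// mule_ge0// poweR_ge0.
have Xfin : X \is a fin_num.
  by rewrite fin_numD !fin_numM ?ge0_fin_numE ?poweR_ge0.
apply/lee_addgt0Pr => e e0.
have x0 : 0 <= fine X by rewrite fine_ge0.
have [|_ [K' admK' <-]] := @ereal_inf_lt _ [set K%:E | K in admissible p n]
    (K + e / (fine X + 1))%:E.
  by rewrite -/(sharp_constant p n) KE lte_fin ltrDl divr_gt0// ltr_wpDl.
rewrite lte_fin => K'K; apply: le_trans (admK' v w Hv Hw) _.
rewrite -/X -(fineK Xfin) -!EFinM -EFinD lee_fin.
apply: (@le_trans _ _ (2^-1 * (K + e / (fine X + 1)) * fine X)).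
  by rewrite ler_wpM2r// ler_wpM2l// ltW.
rewrite mulrDr mulrDl lerD2l -mulrA -[leRHS]mul1r.
apply: ler_pM => //; first by rewrite mulr_ge0// divr_ge0// ?addr_ge0// ltW.
  by rewrite invf_le1// ler1n.
by rewrite -mulrA ger_pMr// ler_pdivrMl ?mulr1 ?lerDl// ltr_wpDl.
Qed.

End SharpConstant.

Section LowerBound.
Variable R : realType.
Implicit Types p n : R.

(* The bound K^<->_pn. All the bases of the powers below are positive and the
   arguments of the square roots nonnegative when n <= p and d/2 < n. *)

Definition Theta_ge3 p n : R :=
  (1 - (n - 1) / (2 * p)) `^ p + ((n + 1) / (2 * p)) `^ p.

Definition Phi_ge3 p n : R :=
  1 + 2 * Num.sqrt (1 - n / p) * Num.sqrt (2 * (n + 1) / p) + (n + 2) / p.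

Definition Psi_ge3 p n : R :=
  1 + 2 * Num.sqrt (1 - n / p) * Num.sqrt (2 * (n + 1) / p) + (3 * n + 4) / p.

Definition lower_bound_ge3 (d : nat) p n : R :=
  1 / (2 * pi) `^ (d%:R / 2) * ((n + 1) / p) `^ ((n + 1) / 2) *
  (Theta_ge3 p n `^ (1 / 2) * 2 `^ (p + n / 2 + 1) /
   (Phi_ge3 p n `^ (p / 2) * Psi_ge3 p n `^ (n / 2 + 1 / 2) +
    Phi_ge3 p n `^ (n / 2) * Psi_ge3 p n `^ (p / 2 + 1 / 2))).

Definition Theta_2 p n : R :=
  (1 + 3 / p) ^+ 2 * (1 - (n - 5) / (2 * p)) `^ (p - 1) +
  4 * ((n + 1) / (2 * p)) `^ (p + 1).

Definition Phi_2 p n : R :=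
  1 + 2 * Num.sqrt (1 - (n - 2) / p) * Num.sqrt (2 * (n + 1) / p) +
  (n + 4) / p.

Definition Psi_2 p n : R :=
  1 + 2 * Num.sqrt (1 - (n - 2) / p) * Num.sqrt (2 * (n + 1) / p) +
  (3 * (n + 2)) / p.

Definition lower_bound_2 p n : R :=
  1 / pi * ((n + 1) / p) `^ ((n + 1) / 2) *
  (Theta_2 p n `^ (1 / 2) * 2 `^ (p + n / 2) /
   (Phi_2 p n `^ (p / 2) * Psi_2 p n `^ (n / 2 + 1) +
    Phi_2 p n `^ (n / 2) * Psi_2 p n `^ (p / 2 + 1))).

(* meant for d >= 2 *)
Definition lower_bound (d : nat) p n : R :=
  if d == 2%N then lower_bound_2 p n else lower_bound_ge3 d p n.

Definition lower_bound_asymptotics (d : nat) p n : R :=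
  2 / (2 * pi) `^ (d%:R / 2) * (expR (5 * (n + 1) / 4) / (expR (n + 1) + 1)) *
  ((n + 1) / p) `^ ((n + 1) / 2) *
  (2 `^ (p + n / 2) / expR (Num.sqrt (2 * (n + 1) * p))).

End LowerBound.

(* Main.v *)
Require Import Defs.
From mathcomp Require Import all_boot all_order all_algebra.
From mathcomp Require Import complex.
From mathcomp Require Import all_classical all_reals all_analysis.
From mathcomp Require Import ring lra.
Import Order.TTheory GRing.Theory Num.Theory.
Import numFieldNormedType.Exports.
Local Open Scope classical_set_scope.
Local Open Scope ring_scope.
Set Implicit Arguments.
Unset Strict Implicit.
Unset Printing Implicit Defensive.

(** The lower bounds come from testing the inequality that defines the sharp
    constant on a pair of single waves.  For integer vectors a, b and real
    amplitudes u orthogonal to a and g orthogonal to b, take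
      v = 2 c cos(a.x) u   and   w = 2 c cos(b.x) g,   c = (2 pi)^(-d/2).
    Then v . dw = - 4 c^2 (u.b) cos(a.x) sin(b.x) g has its Fourier
    coefficients at the four frequencies a+b, b-a, -(a+b), a-b, each of them
    equal to g up to a factor of modulus c |u.b|, and the Leray projection
    replaces g by its component orthogonal to the frequency.  All the norms
    are thus explicit, and every admissible K satisfies [admissible_modes].

    The vectors a and b must be of nearly equal length and nearly parallel,
    for |a+b|^p to be about 2^p |a|^p, but not parallel, since u.b is
    proportional to the sine of their angle; a = (N, 0, ...) and
    b = (N, 1, 0, ...) with u = (0, 1, 0, ...) do this.  In dimension at least
    3 there is room for g = (0, 0, 1, 0, ...), orthogonal to a and b, so that
    the projection loses nothing; in the plane g must be parallel to (-1, N).  The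
    squared lengths are N^2, N^2 + 1, 4 N^2 + 1 and 1 (for b-a).  The best N
    is close to sqrt (p / (2 (n+1))); as N is an integer, it is only known
    that x <= N <= x + 1, where x = sqrt ((p - al) / (2 (n+1))) with al = n
    (al = n-2 in the plane) ([exists_frequency]).  The lower bound on N gives
    Theta in the numerator, and the upper bound, rewritten as
    N^2 <= p / (2 (n+1)) * Phi and N^2 + 1 <= p / (2 (n+1)) * Psi, gives the
    denominator; the powers of p / (2 (n+1)) are collected by
    [lower_bound_rescale].

    For the asymptotics the delicate factors are Phi^(p/2) and Psi^(p/2):
    Phi - 1 is of order p^(-1/2), so the logarithm has to be expanded to the
    second order, with an error term of the third order ([cvgy_log_base]).
    This yields Phi^(p/2) ~ e^(sqrt (2 (n+1) p) + phi) and
    Psi^(p/2) ~ e^(sqrt (2 (n+1) p) + phi + n + 1) for a constant phi, whence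
    the factor e^(n+1) + 1 in the limit.  All other factors converge by
    first-order considerations.  The p-th root is read off from the logarithm
    of the equivalent, in which the term p ln 2 dominates. *)

(** * Integrals of trigonometric polynomials over the torus *)

Section TrigIntegrals.
Variable R : realType.

Lemma Rintegral_FTC (f F : R -> R) (a b : R) : a < b ->
  (forall t, is_derive t (1 : R) F (f t)) -> continuous f ->
  \int[lebesgue_measure]_(t in `[a, b]) f t = F b - F a.
Proof.
move=> ab dF cf; rewrite /Rintegral (continuous_FTC2 (F := F))//.
- exact: continuous_subspaceT.
- have cF : continuous F.
    by move=> x; apply/differentiable_continuous/derivable1_diffP; case: (dF x).
  split=> [x _||]; first by case: (dF x).
  + exact/cvg_at_right_filter/cF.
  + exact/cvg_at_left_filter/cF.
- by move=> x _; rewrite derive1E derive_val.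
Qed.

Lemma sin_int_period (m : int) (x : R) : sin (m%:~R * (2 * pi) + x) = sin x.
Proof.
case: m => n; rewrite addrC.
  have := @periodicn _ _ _ _ (@sinD2pi R) n x.
  by rewrite -[RHS]/(sin x) => <-; congr (sin (_ + _)); rewrite -pmulrn; ring.
rewrite NegzE.
have := @periodicn _ _ _ _ (@sinD2pi R) n.+1 (x + (- n.+1%:Z)%:~R * (2 * pi)).
move=> <-; congr sin; rewrite rmorphN /= -pmulrn; ring.
Qed.

(** The phases [phi] make the cosines a class of functions that is stable under
    freezing one coordinate of the torus, which only shifts the phase; this is
    what the induction on the dimension in [torus_integral_trig_sum] uses. *)
Lemma integral_trig_sum (I : Type) (s : seq I) (A phi : I -> R) (m : I -> int) :
  \int[lebesgue_measure]_(t in `[0, 2 * pi])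
     (\sum_(j <- s) A j * cos ((m j)%:~R * t + phi j)) =
  \sum_(j <- s | m j == 0) 2 * pi * (A j * cos (phi j)).
Proof.
pose F t := \sum_(j <- s) (if m j == 0 then A j * cos (phi j) * t
              else A j / (m j)%:~R * sin ((m j)%:~R * t + phi j)).
have cf : continuous (fun t : R => \sum_(j <- s) A j * cos ((m j)%:~R * t + phi j)).
  elim: s {F} => [|j s IH]; first by under eq_fun do rewrite big_nil; exact: cst_continuous.
  under eq_fun do rewrite big_cons.
  move=> x; apply: cvgD; last exact: IH.
  apply: cvgM; first exact: cvg_cst.
  apply: continuous_comp; last exact: continuous_cos.
  apply: cvgD; last exact: cvg_cst.
  by apply: cvgM; [exact: cvg_cst|exact: cvg_id].
have dF t : is_derive t (1 : R) F (\sum_(j <- s) A j * cos ((m j)%:~R * t + phi j)).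
  rewrite /F; elim: s {F cf} => [|j s IH].
    under eq_fun do rewrite big_nil; rewrite big_nil.
    exact: is_derive_cst.
  under eq_fun do rewrite big_cons; rewrite big_cons.
  apply: is_deriveD.
  case: eqVneq => [->|m0].
    rewrite mul0r add0r; apply: is_derive_eq; rewrite /GRing.scale/=; ring.
  apply: is_derive_eq; rewrite /GRing.scale/=; field.
  by rewrite intr_eq0.
rewrite (Rintegral_FTC _ dF cf) ?mulr_gt0 ?pi_gt0//.
rewrite /F -sumrB [RHS]big_mkcond; apply: eq_bigr => j _.
case: ifP => _; first by ring.
by rewrite sin_int_period mulr0 add0r subrr.
Qed.

Lemma row_mx_head d (t : R) (y : 'rV[R]_d) :
  row_mx (t%:M : 'rV[R]_1) y 0 ord0 = t.
Proof.
rewrite mxE; case: splitP => [j _|k //].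
by rewrite !ord1 mxE eqxx.
Qed.

Lemma row_mx_tail d (t : R) (y : 'rV[R]_d) (r : 'I_d) :
  row_mx (t%:M : 'rV[R]_1) y 0 (lift ord0 r) = y 0 r.
Proof.
rewrite mxE; case: splitP => [j|k]; first by rewrite ord1.
by rewrite lift0 => -[/val_inj ->].
Qed.

Lemma eq_torus_integral d (f g : 'rV[R]_d -> R) :
  f =1 g -> torus_integral f = torus_integral g.
Proof. by move=> /funext ->. Qed.

(** Freezing the first coordinate t turns the phase phi_j into phi_j + m_j0 t,
    so the inner integral is, by induction, a trigonometric sum in t. *)
Lemma torus_integral_trig_sum d (I : Type) (s : seq I) (A phi : I -> R)
    (m : I -> 'rV[int]_d) :
  torus_integral (fun x : 'rV[R]_d =>
     \sum_(j <- s) A j * cos (\sum_r (m j 0 r)%:~R * x 0 r + phi j)) =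
  \sum_(j <- s | m j == 0) (2 * pi) ^+ d * (A j * cos (phi j)).
Proof.
elim: d s A phi m => [|d IH] s A phi m /=.
  rewrite [RHS]big_mkcond; apply: eq_bigr => j _.
  rewrite big_ord0 expr0 mul1r add0r ifT//; apply/eqP/rowP; case=> //.
pose m1 j : 'rV[int]_d := \row_r m j 0 (lift ord0 r).
under eq_Rintegral => t _.
  rewrite (@eq_torus_integral _ _ (fun y : 'rV[R]_d => \sum_(j <- s) A j *
    cos (\sum_r (m1 j 0 r)%:~R * y 0 r + ((m j 0 0)%:~R * t + phi j)))); last first.
    move=> y; apply: eq_bigr => j _; congr (_ * cos _).
    rewrite big_ord_recl -addrA addrCA.
    rewrite row_mx_head; congr (_ + _).
    by apply: eq_bigr => r _; rewrite row_mx_tail mxE.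
  rewrite IH.
  under eq_bigr do rewrite mulrA.
  over.
under eq_Rintegral => t _ do rewrite -big_filter.
rewrite (integral_trig_sum _ (fun j => (2 * pi) ^+ d * A j)) big_filter_cond.
apply: eq_big => [j|j _]; last by rewrite exprS; ring.
apply/andP/eqP => [[/eqP m0 /eqP m00]|mj0].
  apply/rowP => r; rewrite !mxE; case: (unliftP ord0 r) => [r' ->|->//].
  by move/rowP/(_ r') : m0; rewrite !mxE.
by rewrite mj0 mxE; split=> //; apply/eqP/rowP => r; rewrite !mxE mj0 mxE.
Qed.
End TrigIntegrals.

(** * The nonlinearity on a pair of single waves *)

Section Mode.
Local Open Scope complex_scope.
Variables (R : realType) (d : nat).
Local Notation C := R[i].
Implicit Types (a b k : 'rV[int]_d) (u g : 'rV[R]_d) (x : 'rV[R]_d).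

Definition realdot (x y : 'rV[R]_d) : R := \sum_r x 0 r * y 0 r.
Definition realvec k : 'rV[R]_d := map_mx intr k.
(** The Fourier coefficients of 2 c cos(a.x) u, with c = [char_coef], when a is
    not 0. *)
Definition mode a u : coefs R d := fun k =>
  if (k == a) || (k == - a) then map_mx (real_complex R) u else 0.
Definition char_coef : R := (2 * pi) `^ (- (d%:R / 2)).

Lemma int_row_opp_neq a : a != 0 -> a != - a.
Proof.
move=> /rV0Pn[r ar]; apply/eqP => /rowP/(_ r); rewrite mxE => /eqP.
by rewrite -addr_eq0 -mulr2n mulrn_eq0/= (negbTE ar).
Qed.

(** The partial sums are constant as soon as the cube contains a and -a. *)
Lemma lim_cube_sum (f : 'rV[int]_d -> C) a : a != 0 ->
  (forall k, k != a -> k != - a -> f k = 0) ->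
  lim ((\sum_(k \in [set k : 'rV[int]_d | forall r, `|k 0 r| <= N%:Z]) f k : C^o)
         @[N --> \oo]) = f a + f (- a).
Proof.
move=> a0 f0; apply: norm_lim_near_cst.
have leA r : (`|a 0%R r| <= \sum_i `|a 0%R i|)%N by rewrite (bigD1 r)//= leq_addr.
near=> N.
rewrite -(@fsbig_widen _ _ _ _ [set` [:: a; - a]]).
- rewrite -fsbig_seq; first by rewrite big_cons big_seq1.
  by rewrite /= inE int_row_opp_neq.
- have aN r : `|a 0 r| <= N%:Z.
    by rewrite -abszE lez_nat (leq_trans (leA r))//; near: N; exact: nbhs_infty_ge.
  by move=> k /=; rewrite !inE => /orP[] /eqP -> r; rewrite ?mxE ?normrN.
- by move=> k [_ /=]; rewrite !inE => /negP; rewrite negb_or => /andP[? ?]; exact: f0.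
Unshelve. all: by end_near. Qed.

Definition phase k x : R := \sum_r (k 0 r)%:~R * x 0 r.

Lemma phaseN k x : phase (- k) x = - phase k x.
Proof. by rewrite /phase -sumrN; apply: eq_bigr => r _; rewrite mxE rmorphN mulNr. Qed.

Lemma phaseD k l x : phase (k + l) x = phase k x + phase l x.
Proof. by rewrite /phase -big_split/=; apply: eq_bigr => r _; rewrite mxE rmorphD mulrDl. Qed.

Lemma torus_charE k x :
  torus_char k x = (char_coef * cos (phase k x)) +i* (char_coef * sin (phase k x)).
Proof. by rewrite /torus_char -/(phase k x) -/char_coef; simpc. Qed.

Lemma fun_of_mode a u x s : a != 0 ->
  fun_of_coefs (mode a u) x 0 s = (2 * char_coef * u 0 s * cos (phase a x))%:C.
Proof.
move=> a0; rewrite mxE (@lim_cube_sum _ a)//; last first.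
  by move=> k ka kNa; rewrite /mode (negbTE ka) (negbTE kNa)/= mxE mul0r.
rewrite /mode !eqxx orbT/= !mxE !torus_charE phaseN cosN sinN.
by apply/eqP; rewrite eq_complex /=; apply/andP; split; apply/eqP; ring.
Qed.

Lemma imaginaryE : 'i%R = Complex 0 1 :> C. Proof. by []. Qed.

Lemma intr_complex (m : int) : m%:~R = (m%:~R)%:C :> C. Proof. by rewrite rmorph_int. Qed.

Lemma fun_of_partial_mode b g x r s : b != 0 ->
  fun_of_coefs (partial_deriv r (mode b g)) x 0 s =
  (- (2 * char_coef * (b 0 r)%:~R * g 0 s * sin (phase b x)))%:C.
Proof.
move=> b0; rewrite mxE (@lim_cube_sum _ b)//; last first.
  by move=> k ka kNa; rewrite /partial_deriv /mode (negbTE ka) (negbTE kNa)/= scaler0 mxE mul0r.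
rewrite /partial_deriv /mode !eqxx orbT/= !mxE !torus_charE phaseN cosN sinN.
rewrite imaginaryE !intr_complex rmorphN/=.
by apply/eqP; rewrite eq_complex /=; apply/andP; split; apply/eqP; ring.
Qed.

Lemma advection_integrand a b u g x s : a != 0 -> b != 0 ->
  \sum_r fun_of_coefs (mode a u) x 0 r * fun_of_coefs (partial_deriv r (mode b g)) x 0 s
  = (- (4 * char_coef ^+ 2 * realdot u (realvec b) * g 0 s) * (cos (phase a x) * sin (phase b x)))%:C.
Proof.
move=> a0 b0; rewrite /realdot mulr_sumr mulr_suml -sumrN mulr_suml rmorph_sum.
apply: eq_bigr => r _; rewrite fun_of_mode// fun_of_partial_mode// -rmorphM !mxE/=.
congr _%:C; ring.
Qed.

(** The signs with which the four frequencies occur in cos(a.x) sin(b.x), up to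
    the factor 1 / (4 'i). *)
Definition wave_sign a b k : R :=
  (k == a + b)%:R + (k == b - a)%:R - (k == - (a + b))%:R - (k == a - b)%:R.

(** The product-to-sum formulas turn the integrand into a sum of sines, that is
    of cosines with phase - pi / 2, whose mean vanishes even at frequency 0. *)
Lemma integral_triple_cos a b k (B : R) :
  torus_integral (fun x => B * (cos (phase a x) * sin (phase b x)) * cos (phase k x)) = 0.
Proof.
rewrite (@eq_torus_integral _ _ _ (fun x =>
   \sum_(m <- [:: a + b + k; b - a + k; a + b - k; b - a - k])
     (B / 4) * cos (phase m x + (- (pi / 2))))); last first.
  move=> x; rewrite !big_cons big_nil !cosBpihalf !phaseD !phaseN.
  rewrite !(sinD, cosD) !cosN !sinN; by field.
apply: (etrans (torus_integral_trig_sum _ (fun=> B / 4) (fun=> - (pi / 2)) id)).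
by rewrite big1// => m _; rewrite cosN cos_pihalf !mulr0.
Qed.

Lemma integral_triple_sin a b k (B : R) :
  torus_integral (fun x => B * (cos (phase a x) * sin (phase b x)) * sin (phase k x)) =
  B / 4 * (2 * pi) ^+ d * wave_sign a b k.
Proof.
rewrite (@eq_torus_integral _ _ _ (fun x =>
   \sum_(m <- [:: (B / 4, a + b - k); (B / 4, b - a - k);
                  (- (B / 4), a + b + k); (- (B / 4), b - a + k)])
     m.1 * cos (phase m.2 x + 0))); last first.
  move=> x; rewrite !big_cons big_nil /= !addr0 !phaseD !phaseN.
  rewrite !(sinD, cosD) !cosN !sinN; by field.
apply: (etrans (torus_integral_trig_sum _ fst (fun=> 0) snd)).
rewrite big_mkcond !big_cons big_nil/= cos0 !mulr1 /wave_sign.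
(* frequency 0 occurs in the expansion exactly when k is one of the four
   frequencies of the product *)
have e1 : (a + b - k == 0) = (k == a + b) by rewrite subr_eq0 eq_sym.
have e2 : (b - a - k == 0) = (k == b - a) by rewrite subr_eq0 eq_sym.
have e3 : (a + b + k == 0) = (k == - (a + b)) by rewrite addrC addr_eq0.
have e4 : (b - a + k == 0) = (k == a - b) by rewrite addrC addr_eq0 opprB.
rewrite e1 e2 e3 e4.
by do 4 case: (k == _) => /=; rewrite ?mulr1n ?mulr0n; ring.
Qed.

Lemma char_coef_pow : char_coef ^+ 2 * (2 * pi) ^+ d = 1.
Proof.
have p2 : 0 < 2 * pi :> R by rewrite mulr_gt0 ?pi_gt0.
rewrite /char_coef -powR_mulrn ?powR_ge0// -powRrM -powR_mulrn ?ltW//.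
rewrite -powRD; last by rewrite (gt_eqF p2) implybT.
by rewrite (_ : _ + _ = 0) ?powRr0//; field.
Qed.

Lemma advection_modes a b u g k : a != 0 -> b != 0 ->
  advection (mode a u) (mode b g) k =
  ((char_coef * realdot u (realvec b) * wave_sign a b k) *i) *: map_mx (real_complex R) g.
Proof.
move=> a0 b0; apply/rowP => s; rewrite !mxE /=.
set B := - (4 * char_coef ^+ 3 * realdot u (realvec b) * g 0 s).
under eq_torus_integral => x.
  rewrite mxE advection_integrand// torus_charE.
  over.
rewrite /=.
have -> : torus_integral (fun x : 'rV[R]_d => complex.Im
   ((\row_s0 \sum_r fun_of_coefs (mode a u) x 0 r *
      fun_of_coefs (partial_deriv r (mode b g)) x 0 s0) 0 s * (torus_char k x)^*)) =
   torus_integral (fun x => (- B) * (cos (phase a x) * sin (phase b x)) * sin (phase k x)).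
  apply: eq_torus_integral => x; rewrite mxE advection_integrand// torus_charE/= /B; ring.
rewrite [X in X +i* _](_ : _ = torus_integral (fun x =>
    B * (cos (phase a x) * sin (phase b x)) * cos (phase k x))); last first.
  apply: eq_torus_integral => x/=; rewrite /B; ring.
rewrite integral_triple_cos integral_triple_sin.
apply/eqP; rewrite eq_complex /=; apply/andP; split; apply/eqP; first by ring.
rewrite mul0r add0r -[RHS]mul1r -[X in _ = X * _]char_coef_pow /B; by field.
Qed.

End Mode.

(** * Norms of single waves and the inequality they impose on K *)

Section Norms.
Local Open Scope complex_scope.
Variables (R : realType) (d : nat).
Local Notation C := R[i].
Implicit Types (a b k : 'rV[int]_d) (u g h : 'rV[R]_d) (x : 'rV[R]_d).

Definition sqnorm k : R := realdot (realvec R k) (realvec R k).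

Lemma realdot_ge0 u : 0 <= realdot u u.
Proof. by apply: sumr_ge0 => r _; rewrite -expr2 sqr_ge0. Qed.

Lemma realdotDl u h g : realdot (u + h) g = realdot u g + realdot h g.
Proof. by rewrite /realdot -big_split; apply: eq_bigr => r _; rewrite mxE mulrDl. Qed.
Lemma realdotC u h : realdot u h = realdot h u.
Proof. by apply: eq_bigr => r _; rewrite mulrC. Qed.
Lemma realdotZl t u h : realdot (t *: u) h = t * realdot u h.
Proof. by rewrite /realdot mulr_sumr; apply: eq_bigr => r _; rewrite mxE mulrA. Qed.

Lemma zvecE k : zvec R k = map_mx (real_complex R) (realvec R k).
Proof. by apply/rowP => r; rewrite !mxE intr_complex. Qed.

(** All the coefficients that occur are complex multiples of real vectors, on
    which the Hermitian norm is the Euclidean one up to the modulus of the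
    factor. *)
Lemma cnorm_sqr (z : C) h :
  cnorm (z *: map_mx (real_complex R) h) ^+ 2 =
  (complex.Re z ^+ 2 + complex.Im z ^+ 2) * realdot h h.
Proof.
have E : complex.Re (cdot (map_mx conjc (z *: map_mx (real_complex R) h))
   (z *: map_mx (real_complex R) h)) = (complex.Re z ^+ 2 + complex.Im z ^+ 2) * realdot h h.
  rewrite /cdot raddf_sum /realdot mulr_sumr; apply: eq_bigr => r _; rewrite !mxE.
  by case: z => x y /=; ring.
by rewrite /cnorm E sqr_sqrtr// mulr_ge0 ?realdot_ge0// addr_ge0 ?sqr_ge0.
Qed.

Lemma cnorm_real h : cnorm (map_mx (real_complex R) h) ^+ 2 = realdot h h.
Proof. by rewrite -[map_mx _ _]scale1r cnorm_sqr/=; ring. Qed.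

Lemma cnorm_zvec_powR k m : cnorm (zvec R k) `^ (2 * m) = sqnorm k `^ m.
Proof.
by rewrite powRrM powR_mulrn ?sqrtr_ge0// zvecE cnorm_real.
Qed.

Lemma sqnorm_ge1 k : k != 0 -> 1 <= sqnorm k.
Proof.
move=> /(@cnorm_zvec_ge1 R d) k1; rewrite /sqnorm -cnorm_real -zvecE.
by rewrite -[1](expr1n _ 2%N) lerXn2r// nnegrE ?sqrtr_ge0.
Qed.

Lemma sqnormN k : sqnorm (- k) = sqnorm k.
Proof. by apply: eq_bigr => r _; rewrite !mxE rmorphN mulrNN. Qed.

(** A Sobolev norm dominates its partial sums; this spares the evaluation of
    the advection term away from the four relevant frequencies. *)
Lemma hnorm_ge m (v : coefs R d) (s : seq 'rV[int]_d) : uniq s -> 0 \notin s ->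
  (((\sum_(k <- s) sqnorm k `^ m * cnorm (v k) ^+ 2) `^ 2^-1)%:E <= hnorm m v)%E.
Proof.
move=> us s0; rewrite -poweR_EFin /hnorm; apply: gt0_ler_poweR => //.
- by rewrite in_itv/= leey lee_fin sumr_ge0// => k _; rewrite mulr_ge0 ?powR_ge0 ?sqr_ge0.
- rewrite in_itv/= leey esum_ge0// => k _; rewrite lee_fin mulr_ge0 ?powR_ge0 ?sqr_ge0//.
apply: esum_ge; exists [set` s].
  by split; [exact: finite_seq|move=> k /= ks; apply: contraNneq s0 => <-].
rewrite -fsbig_seq// -sumEFin; apply: lee_sum => k _.
by rewrite cnorm_zvec_powR.
Qed.

Lemma hnorm_mode m a u : a != 0 ->
  hnorm m (mode a u) = ((2 * (sqnorm a `^ m * realdot u u)) `^ 2^-1)%:E.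
Proof.
move=> a0; rewrite -poweR_EFin /hnorm; congr poweR.
set s := [:: a; - a].
have sub : [set k | k != 0] `&` [set` s] = [set` s].
  apply/setIidr => k /=; rewrite !inE => /orP[] /eqP -> //; by rewrite oppr_eq0.
transitivity (\esum_(k in [set k : 'rV[int]_d | k != 0] `&` [set` s])
   (sqnorm k `^ m * cnorm (mode a u k) ^+ 2)%:E).
  rewrite esum_mkcondr; apply: eq_esum => k _; rewrite cnorm_zvec_powR.
  case: ifPn => //; rewrite notin_setE /= !inE /mode => /negP/negbTE ->.
  rewrite -[X in cnorm X](map_mx0 (real_complex R)) cnorm_real /realdot.
  by rewrite big1 ?mulr0// => r _; rewrite mxE mul0r.
rewrite sub esum_fset; [|exact: finite_seq|]; last first.
  by move=> k _; rewrite lee_fin mulr_ge0 ?powR_ge0 ?sqr_ge0.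
rewrite -fsbig_seq; last by rewrite /= inE int_row_opp_neq.
rewrite big_cons big_seq1 /mode !eqxx orbT/= cnorm_real sqnormN -EFinD; congr _%:E; ring.
Qed.

Lemma cdot_real (z : C) h g :
  cdot (map_mx (real_complex R) h) (z *: map_mx (real_complex R) g) = z * (realdot h g)%:C.
Proof.
rewrite /cdot /realdot rmorph_sum mulr_sumr; apply: eq_bigr => r _.
by rewrite !mxE rmorphM; ring.
Qed.

Lemma hspace_mode m a u : a != 0 -> realdot (realvec R a) u = 0 ->
  hspace m (mode a u).
Proof.
move=> a0 au; split.
- split.
    move=> k; rewrite /mode !eqr_oppLR opprK orbC.
    by case: ifP => _; apply/rowP => r; rewrite !mxE ?conjc_real ?conjc0.
  exists (cnorm (map_mx (real_complex R) u)), 0 => k; rewrite powRr0 mulr1 /mode.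
  case: ifP => // _; rewrite /cnorm.
  rewrite /cdot big1 ?raddf0 ?sqrtr0 ?sqrtr_ge0//.
  by move=> r _; rewrite !mxE mulr0.
- move=> k; rewrite /mode; case: ifP => [/orP[] /eqP ->|_].
  + by rewrite zvecE -[map_mx _ u]scale1r cdot_real au mulr0.
  + rewrite zvecE -[map_mx _ u]scale1r cdot_real.
    rewrite (_ : realvec R (- a) = (-1) *: realvec R a); last first.
      by apply/rowP => r; rewrite !mxE rmorphN mulN1r.
    by rewrite realdotZl au !mulr0.
  + by rewrite /cdot big1// => r _; rewrite !mxE mulr0.
- by rewrite /mode eq_sym (negbTE a0) eq_sym oppr_eq0 (negbTE a0).
- by rewrite hnorm_mode// ltry.
Qed.

(** The squared length of the component of g orthogonal to k, by Pythagoras. *)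
Definition perp_sqnorm k g : R :=
  realdot g g - realdot (realvec R k) g ^+ 2 / sqnorm k.

Lemma leray_sqnorm (v : coefs R d) k (z : C) g : k != 0 ->
  v k = z *: map_mx (real_complex R) g ->
  cnorm (leray v k) ^+ 2 = (complex.Re z ^+ 2 + complex.Im z ^+ 2) * perp_sqnorm k g.
Proof.
move=> k0 vk; rewrite /leray (negbTE k0) vk.
set t := realdot (realvec R k) g / sqnorm k.
have -> : cdot (zvec R k) (z *: map_mx (real_complex R) g) / (cnorm (zvec R k) ^+ 2)%:C
    *: zvec R k = z *: map_mx (real_complex R) (t *: realvec R k).
  rewrite zvecE cdot_real cnorm_real -/(sqnorm k) -fmorphV -mulrA -rmorphM -/t.
  by rewrite map_mxZ scalerA.
rewrite -scalerBr -map_mxB cnorm_sqr; congr (_ * _).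
rewrite -scaleNr realdotDl !realdotZl ![realdot _ (_ + _)]realdotC !realdotDl !realdotZl.
rewrite /perp_sqnorm (realdotC g) -/(sqnorm k) /t; field.
by rewrite gt_eqF// (lt_le_trans ltr01)// sqnorm_ge1.
Qed.

Lemma perp_sqnormN k g : perp_sqnorm (- k) g = perp_sqnorm k g.
Proof.
rewrite /perp_sqnorm sqnormN (_ : realvec R (- k) = (-1) *: realvec R k).
  by rewrite realdotZl mulN1r sqrrN.
by apply/rowP => r; rewrite !mxE rmorphN mulN1r.
Qed.

Lemma perp_sqnorm_ge0 k g : k != 0 -> 0 <= perp_sqnorm k g.
Proof.
move=> k0; have := @leray_sqnorm (fun=> 1 *: map_mx (real_complex R) g) k 1 g k0 erefl.
by rewrite /= expr1n expr0n addr0 mul1r => <-; exact: sqr_ge0.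
Qed.

Lemma powR_half (x m : R) : (x `^ m) `^ 2^-1 = x `^ (m / 2).
Proof. by rewrite powRrM. Qed.

Lemma sqr_wave_sign a b k : uniq [:: a + b; b - a; - (a + b); a - b] ->
  k \in [:: a + b; b - a; - (a + b); a - b] -> wave_sign R a b k ^+ 2 = 1.
Proof.
rewrite /wave_sign; set k1 := a + b; set k2 := b - a; set k3 := - k1; set k4 := a - b.
rewrite /= !inE !negb_or => /and4P[/and3P[/negbTE e1 /negbTE e2 /negbTE e3]].
move=> /andP[/negbTE e4 /negbTE e5] /negbTE e6 _.
case/or4P => /eqP ->; rewrite eqxx ?(eq_sym k2 k1) ?(eq_sym k3 k1) ?(eq_sym k4 k1)
  ?(eq_sym k3 k2) ?(eq_sym k4 k2) ?(eq_sym k4 k3) ?e1 ?e2 ?e3 ?e4 ?e5 ?e6 /=; ring.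
Qed.

(** The defining inequality of K tested on a pair of waves: the left-hand side
    bounds the norm of the projected advection term from below, the
    frequencies k and -k giving equal contributions. *)
Lemma admissible_modes (p n K : R) a b u g :
  a != 0 -> b != 0 -> realdot (realvec R a) u = 0 -> realdot (realvec R b) g = 0 ->
  uniq [:: a + b; b - a; - (a + b); a - b] ->
  admissible d p n K ->
  char_coef R d * `|realdot u (realvec R b)| *
    Num.sqrt (2 * (sqnorm (a + b) `^ p * perp_sqnorm (a + b) g +
                   sqnorm (b - a) `^ p * perp_sqnorm (b - a) g)) <=
  K * (Num.sqrt (realdot u u) * Num.sqrt (realdot g g)) *
    (sqnorm a `^ (p / 2) * sqnorm b `^ ((n + 1) / 2) +
     sqnorm a `^ (n / 2) * sqnorm b `^ ((p + 1) / 2)).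
Proof.
move=> a0 b0 au bg us adm.
set s := [:: _; _; _; _] in us.
have sN0 : 0 \notin s.
  have ab0 : a + b != 0.
    apply: contraTneq us => e; rewrite /s e oppr0 /= !inE eqxx ?orbT//=.
  have ba0 : b - a != 0.
    apply: contraTneq us => e; rewrite /s -(opprB b) e oppr0 /= !inE eqxx ?orbT//=.
    by rewrite ?orbT andbF.
  by rewrite !inE !negb_or ![0 == _]eq_sym oppr_eq0 ab0 ba0 -(opprB b) oppr_eq0 ba0.
have := hnorm_ge p (proj_advection (mode a u) (mode b g)) us sN0.
have := adm _ _ (hspace_mode p a0 au) (hspace_mode (p + 1) b0 bg).
rewrite !hnorm_mode// -!EFinM => le1 le2.
have := le_trans le2 le1; rewrite lee_fin {le1 le2 adm}.
set G := char_coef R d * realdot u (realvec R b).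
have projE k : k \in s ->
    cnorm (proj_advection (mode a u) (mode b g) k) ^+ 2 = G ^+ 2 * perp_sqnorm k g.
  move=> ks; have k0 : k != 0 by apply: contraNneq sN0 => <-.
  rewrite (leray_sqnorm k0 (advection_modes u g k a0 b0)) /= expr0n add0r.
  by rewrite exprMn sqr_wave_sign// mulr1.
under eq_big_seq => k ks do rewrite projE//.
rewrite /s !big_cons big_nil -(opprB b a) !sqnormN !perp_sqnormN addr0.
set S := _ + sqnorm (b - a) `^ p * _.
have -> : sqnorm (a + b) `^ p * (G ^+ 2 * perp_sqnorm (a + b) g) +
  (sqnorm (b - a) `^ p * (G ^+ 2 * perp_sqnorm (b - a) g) +
   (sqnorm (a + b) `^ p * (G ^+ 2 * perp_sqnorm (a + b) g) +
    sqnorm (b - a) `^ p * (G ^+ 2 * perp_sqnorm (b - a) g))) = G ^+ 2 * (2 * S).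
  by rewrite /S; ring.
have pw (x : 'rV[int]_d) (y m : R) : 0 <= y -> (2 * (sqnorm x `^ m * y)) `^ 2^-1 =
    Num.sqrt 2 * (sqnorm x `^ (m / 2) * Num.sqrt y).
  move=> y0; rewrite !powRM ?mulr_ge0 ?powR_ge0//.
  by rewrite powR12_sqrt// (powR12_sqrt y0) powR_half// realdot_ge0.
rewrite !pw ?realdot_ge0//.
have S0 : 0 <= S.
  have sneq0 k : k \in s -> k != 0 by move=> ks; apply: contraNneq sN0 => <-.
  by rewrite addr_ge0// mulr_ge0 ?powR_ge0 ?perp_sqnorm_ge0// sneq0// !inE eqxx ?orbT.
rewrite powR12_sqrt; last exact: mulr_ge0 (sqr_ge0 _) (mulr_ge0 (ler0n _ _) S0).
rewrite sqrtrM ?sqr_ge0// sqrtr_sqr normrM.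
rewrite (ger0_norm (powR_ge0 _ _)) => /le_trans; apply.
rewrite le_eqVlt; apply/orP; left; apply/eqP.
have r2 : Num.sqrt 2 ^+ 2 = 2 :> R by exact: sqr_sqrtr.
have r0 : Num.sqrt 2 != 0 :> R by rewrite sqrtr_eq0 -ltNge.
rewrite [X in X * K * _](_ : _ = (Num.sqrt 2 ^+ 2)^-1); last by rewrite r2.
by field.
Qed.
End Norms.

(** * The waves (N, 0) and (N, 1) *)

Section Instances.
Variable R : realType.

(** Vectors given by their first coordinates and completed by zeros, so that the
    same waves make sense in every dimension. *)
Definition seqrow (T : nmodType) d (s : seq T) : 'rV[T]_d := \row_(r < d) s`_r.

Lemma realdot_seqrow d (s t : seq R) : (size s <= d)%N ->
  realdot (seqrow d s) (seqrow d t) = \sum_(i < size s) s`_i * t`_i.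
Proof.
move=> sd; rewrite (big_ord_widen _ (fun i => s`_i * t`_i) sd) big_mkcond.
apply: eq_bigr => i _; rewrite !mxE; case: ltnP => // si.
by rewrite nth_default ?mul0r.
Qed.

Lemma realvec_seqrow d (s : seq int) :
  realvec R (seqrow d s) = seqrow d [seq i%:~R | i <- s].
Proof.
apply/rowP => r; rewrite !mxE; have [rs|rs] := ltnP r (size s).
  by rewrite (nth_map 0).
by rewrite !nth_default ?size_map.
Qed.

Section Pair.
Variables (d N : nat) (d2 : (2 <= d)%N) (N0 : (0 < N)%N).

Definition wave_a : 'rV[int]_d := seqrow d [:: N%:Z; 0].
Definition wave_b : 'rV[int]_d := seqrow d [:: N%:Z; 1].

Lemma waveD : wave_a + wave_b = seqrow d [:: 2 * N%:Z; 1].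
Proof.
apply/rowP => -[[|[|r]] rd]; rewrite !mxE /= ?nth_nil//; by rewrite mulrC mulr2n mulrDr mulr1.
Qed.

Lemma waveB : wave_b - wave_a = seqrow d [:: 0; 1].
Proof. apply/rowP => -[[|[|r]] rd]; rewrite !mxE /= ?nth_nil//; by rewrite subrr. Qed.

Lemma seqrow2_eq0 (x y : int) : (seqrow d [:: x; y] == 0) = (x == 0) && (y == 0).
Proof.
apply/eqP/andP => [/rowP e|[/eqP -> /eqP ->]].
  by split; apply/eqP; [have := e (Ordinal (ltnW d2))|have := e (Ordinal d2)]; rewrite !mxE.
by apply/rowP => -[[|[|r]] rd]; rewrite !mxE /= ?nth_nil.
Qed.

Lemma wave_a_neq0 : wave_a != 0.
Proof. by rewrite seqrow2_eq0 eqxx andbT; case: N N0. Qed.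

Lemma wave_b_neq0 : wave_b != 0.
Proof. by rewrite seqrow2_eq0 andbF. Qed.

(** The four frequencies are told apart by the sign of the second coordinate
    and by the vanishing of the first one. *)
Lemma wave_uniq : uniq [:: wave_a + wave_b; wave_b - wave_a;
  - (wave_a + wave_b); wave_a - wave_b].
Proof.
rewrite -(opprB wave_b) waveD waveB /= !inE !negb_or.
have c0 (s t : seq int) : s`_0 != t`_0 -> seqrow d s != seqrow d t.
  by apply: contraNneq => /rowP/(_ (Ordinal (ltnW d2))); rewrite !mxE => ->.
have c1 (s t : seq int) : s`_1 != t`_1 -> seqrow d s != seqrow d t.
  by apply: contraNneq => /rowP/(_ (Ordinal d2)); rewrite !mxE => ->.
have opE (x y : int) : - seqrow d [:: x; y] = seqrow d [:: - x; - y].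
  by apply/rowP => -[[|[|r]] rd]; rewrite !mxE /= ?nth_nil ?oppr0.
have N2 : 2 * N%:Z != 0 by rewrite mulf_neq0//; case: N N0.
by rewrite !opE oppr0; apply/and4P; split=> //; repeat (apply/andP; split); 
  first [exact: c1 | apply: c0 => //=; rewrite ?oppr_eq0 // eq_sym oppr_eq0].
Qed.

Definition sqN : R := N%:R ^+ 2.

Lemma sqnorm_wave_a : sqnorm R wave_a = sqN.
Proof.
rewrite /sqnorm realvec_seqrow realdot_seqrow// !big_ord_recl big_ord0 /= /sqN -pmulrn; ring.
Qed.
Lemma sqnorm_wave_b : sqnorm R wave_b = sqN + 1.
Proof.
rewrite /sqnorm realvec_seqrow realdot_seqrow// !big_ord_recl big_ord0 /= /sqN -pmulrn; ring.
Qed.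
Lemma sqnorm_waveD : sqnorm R (wave_a + wave_b) = 4 * sqN + 1.
Proof.
rewrite waveD /sqnorm realvec_seqrow realdot_seqrow// !big_ord_recl big_ord0 /= /sqN.
rewrite intrM -!pmulrn; ring.
Qed.
Lemma sqnorm_waveB : sqnorm R (wave_b - wave_a) = 1.
Proof.
rewrite waveB /sqnorm realvec_seqrow realdot_seqrow// !big_ord_recl big_ord0 /=; ring.
Qed.

(** In dimension at least 3 the amplitude (0, 0, 1, 0, ...) of the second wave
    is orthogonal to every frequency involved, and is fixed by the Leray
    projection. *)
Lemma admissible_transverse (p n K : R) : (3 <= d)%N -> admissible d p n K ->
  char_coef R d * Num.sqrt (2 * ((4 * sqN + 1) `^ p + 1)) <=
  K * (sqN `^ (p / 2) * (sqN + 1) `^ ((n + 1) / 2) +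
     sqN `^ (n / 2) * (sqN + 1) `^ ((p + 1) / 2)).
Proof.
move=> d3 adm.
pose u : 'rV[R]_d := seqrow d [:: 0; 1; 0].
pose g : 'rV[R]_d := seqrow d [:: 0; 0; 1].
have orth (x y : int) : realdot (realvec R (seqrow d [:: x; y])) g = 0.
  by rewrite realvec_seqrow realdot_seqrow// !big_ord_recl big_ord0 /=; ring.
have uu : realdot u u = 1 by rewrite realdot_seqrow// !big_ord_recl big_ord0 /=; ring.
have gg : realdot g g = 1 by rewrite realdot_seqrow// !big_ord_recl big_ord0 /=; ring.
have au : realdot (realvec R wave_a) u = 0.
  by rewrite realvec_seqrow realdot_seqrow// !big_ord_recl big_ord0 /=; ring.
have ub : realdot u (realvec R wave_b) = 1.
  by rewrite realvec_seqrow realdot_seqrow// !big_ord_recl big_ord0 /=; ring.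
have := admissible_modes wave_a_neq0 wave_b_neq0 au (orth _ _) wave_uniq adm.
rewrite ub uu gg normr1 sqrtr1 !mulr1 sqnorm_waveD sqnorm_waveB sqnorm_wave_a sqnorm_wave_b.
by rewrite /perp_sqnorm waveD waveB !orth gg expr0n/= !mul0r subr0 !mulr1 powR1.
Qed.

(** Orthogonality to b = (N, 1) in the plane leaves only the direction (-1, N)
    for g, here taken with squared length N^2 + 1.  The Leray
    projection shortens it at the frequency (2 N, 1), to the squared length
    (2 N^2 + 1)^2 / (4 N^2 + 1), and at the frequency (0, 1) to length 1. *)
Lemma admissible_planar (p n K : R) : admissible d p n K ->
  char_coef R d * Num.sqrt (2 * ((4 * sqN + 1) `^ p * ((2 * sqN + 1) ^+ 2 / (4 * sqN + 1)) + 1)) <=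
  K * Num.sqrt (sqN + 1) * (sqN `^ (p / 2) * (sqN + 1) `^ ((n + 1) / 2) +
     sqN `^ (n / 2) * (sqN + 1) `^ ((p + 1) / 2)).
Proof.
move=> adm.
pose u : 'rV[R]_d := seqrow d [:: 0; 1].
pose g : 'rV[R]_d := seqrow d [:: -1; N%:R].
have uu : realdot u u = 1 by rewrite realdot_seqrow// !big_ord_recl big_ord0 /=; ring.
have gg : realdot g g = sqN + 1 by rewrite realdot_seqrow// !big_ord_recl big_ord0 /= /sqN; ring.
have au : realdot (realvec R wave_a) u = 0.
  by rewrite realvec_seqrow realdot_seqrow// !big_ord_recl big_ord0 /=; ring.
have ub : realdot u (realvec R wave_b) = 1.
  by rewrite realvec_seqrow realdot_seqrow// !big_ord_recl big_ord0 /=; ring.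
have bg : realdot (realvec R wave_b) g = 0.
  by rewrite realvec_seqrow realdot_seqrow// !big_ord_recl big_ord0 /= -pmulrn; ring.
have sumg : realdot (realvec R (seqrow d [:: 2 * N%:Z; 1])) g = - N%:R.
  by rewrite realvec_seqrow realdot_seqrow// !big_ord_recl big_ord0 /= intrM -!pmulrn; ring.
have difg : realdot (realvec R (seqrow d [:: 0; 1])) g = N%:R.
  by rewrite realvec_seqrow realdot_seqrow// !big_ord_recl big_ord0 /=; ring.
have := admissible_modes wave_a_neq0 wave_b_neq0 au bg wave_uniq adm.
rewrite /perp_sqnorm sqnorm_waveD sqnorm_waveB sqnorm_wave_a sqnorm_wave_b.
rewrite waveD waveB ub uu gg sumg difg normr1 sqrtr1 mulr1 mul1r powR1 -/sqN.
rewrite sqrrN -/sqN divr1 mul1r [sqN + 1 - sqN]addrAC subrr add0r.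
rewrite (_ : sqN + 1 - sqN / (4 * sqN + 1) = (2 * sqN + 1) ^+ 2 / (4 * sqN + 1))// addrAC.
have := sqr_ge0 (N%:R : R); rewrite -/sqN => s0.
by field; rewrite gt_eqF// ltr_wpDl// mulr_ge0.
Qed.
End Pair.
End Instances.

(** * Choice of N and rescaling of the bound *)

Section Bounds.
Variable R : realType.
Implicit Types p n al : R.

(** N is the integer following x = sqrt ((p - al) / (2 (n+1))).  The upper bound
    is (x + 1)^2 = x^2 + 2 x + 1 with p / (2 (n+1)) factored out; the product
    of square roots is x divided by that factor. *)
Lemma exists_frequency p n al : 0 < p -> 0 < n + 1 -> al <= p ->
  exists N : nat, [/\ (0 < N)%N, (p - al) / (2 * (n + 1)) <= sqN R N &
   sqN R N <= p / (2 * (n + 1)) *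
     (1 + 2 * Num.sqrt (1 - al / p) * Num.sqrt (2 * (n + 1) / p) +
      (2 * (n + 1) - al) / p)].
Proof.
move=> p0 n0 alp.
set y := (p - al) / (2 * (n + 1)); set x := Num.sqrt y.
have y0 : 0 <= y by rewrite divr_ge0 ?subr_ge0// mulr_ge0// ltW.
have x0 : 0 <= x by exact: sqrtr_ge0.
have x2 : x ^+ 2 = y by rewrite sqr_sqrtr.
have /andP[tx xt] := truncn_itv x0.
exists (Num.truncn x).+1; split=> //; rewrite /sqN.
  by rewrite -x2 lerXn2r ?nnegrE// ltW.
have sE : p / (2 * (n + 1)) * (Num.sqrt (1 - al / p) * Num.sqrt (2 * (n + 1) / p)) = x.
  have s0 : 0 <= p / (2 * (n + 1)) by rewrite divr_ge0 ?mulr_ge0 ?ltW.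
  rewrite -[X in X * _](@sqr_sqrtr _ (p / (2 * (n + 1))))// expr2.
  have h0 : 0 <= 1 - al / p by rewrite subr_ge0 ler_pdivrMr ?mul1r.
  rewrite mulrACA -!sqrtrM ?(mulr_ge0 s0 h0)//.
  congr Num.sqrt; rewrite /y; field; by rewrite !gt_eqF.
apply: (@le_trans _ _ ((x + 1) ^+ 2)).
  by rewrite lerXn2r ?nnegrE ?addr_ge0// -natr1 lerD2r.
rewrite sqrrD expr1n mulr1 x2 -sE -mulr_natl le_eqVlt; apply/orP; left; apply/eqP.
rewrite /y; field; by rewrite !gt_eqF.
Qed.

(** Both products on the left are monotone in X and Y and homogeneous of degree
    (p + n) / 2 + e, so that the scale s comes out. *)
Lemma powR_sum_le (s X Y F G p n e : R) : 0 < s -> 0 <= X -> 0 <= Y ->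
  X <= s * F -> Y <= s * G -> 0 <= p -> 0 <= n -> 0 <= e ->
  X `^ (p / 2) * Y `^ (n / 2 + e) + X `^ (n / 2) * Y `^ (p / 2 + e) <=
  s `^ ((p + n) / 2 + e) *
    (F `^ (p / 2) * G `^ (n / 2 + e) + F `^ (n / 2) * G `^ (p / 2 + e)).
Proof.
move=> s0 X0 Y0 XF YG p0 n0 e0.
have F0 : 0 <= F by rewrite -(pmulr_rge0 _ s0) (le_trans X0).
have G0 : 0 <= G by rewrite -(pmulr_rge0 _ s0) (le_trans Y0).
have E a b : 0 <= a -> 0 <= b -> a + b = (p + n) / 2 + e ->
  X `^ a * Y `^ b <= s `^ ((p + n) / 2 + e) * (F `^ a * G `^ b).
  move=> a0 b0 <-; rewrite powRD ?(gt_eqF s0) ?implybT// mulrACA.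
  have s0' := ltW s0; rewrite -!powRM//.
  by apply: ler_pM; rewrite ?powR_ge0// ge0_ler_powR// nnegrE mulr_ge0.
rewrite mulrDr lerD// E//; rewrite ?addr_ge0 ?divr_ge0//; by field.
Qed.

(** Positivity of L, and hence of K, is what allows the passage from D to the
    larger D'. *)
Lemma ler_pdiv_weaken (K L D D' c : R) :
  0 < L -> 0 <= c -> c <= L -> 0 < D -> D <= D' -> L <= K * D ->
  c / D' <= K.
Proof.
move=> L0 c0 cL D0 DD LK.
have K0 : 0 < K by rewrite -(pmulr_lgt0 _ D0) (lt_le_trans L0).
rewrite ler_pdivrMr; last exact: lt_le_trans DD.
by rewrite (le_trans cL)// (le_trans LK)// ler_pM2l.
Qed.

Lemma char_coef_gt0 d : 0 < char_coef R d.
Proof. by rewrite powR_gt0// mulr_gt0 ?pi_gt0. Qed.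

Lemma sqrt_powR_half (x : R) : 0 <= x -> Num.sqrt x = x `^ (1 / 2).
Proof. by move=> x0; rewrite div1r powR12_sqrt. Qed.

(** With t = (n+1) / p, the numerator of the bound is at the scale
    2 / t = 4 p / (2 (n+1)), as |a+b|^2 is, and its denominator at the scale
    1 / (2 t) = p / (2 (n+1)), as |a|^2 and |b|^2 are.  The exponents f and e
    take the values 0 and 1/2 in dimension at least 3, 1 and 1 in the plane. *)
Lemma lower_bound_rescale (t th D p n e f : R) : 0 < t -> 0 <= th ->
  Num.sqrt (2 * ((2 / t) `^ (p + f) * th)) / ((1 / (2 * t)) `^ ((p + n) / 2 + e) * D) =
  2 `^ (p + n / 2 + (1 + f) / 2 + e) * t `^ (n / 2 + e - f / 2) * (th `^ (1 / 2) / D).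
Proof.
move=> t0 th0.
have invp (x a : R) : 0 < x -> (x^-1) `^ a = x `^ (- a).
  by move=> x0; rewrite -powR_inv1 ?ltW// -powRrM mulN1r.
have t1 : 0 <= t^-1 by rewrite invr_ge0 ltW.
have A a : (2 / t) `^ a = 2 `^ a * t `^ (- a) by rewrite powRM// invp.
have B a : (1 / (2 * t)) `^ a = 2 `^ (- a) * t `^ (- a).
  by rewrite div1r invp ?mulr_gt0// powRM// ltW.
have X0 : 0 <= (2 / t) `^ (p + f) * th by rewrite mulr_ge0 ?powR_ge0.
rewrite sqrt_powR_half ?(mulr_ge0 _ X0)// !(powRM _ (ler0n _ _) X0) (powRM _ (powR_ge0 _ _) th0).
rewrite -powRrM A B !invfM -!powRN !opprK.
set c := (p + n) / 2 + e; set a := (p + f) * (1 / 2).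
have -> : p + n / 2 + (1 + f) / 2 + e = 1 / 2 + a + c by rewrite /a /c; field.
have -> : n / 2 + e - f / 2 = - a + c by rewrite /a /c; field.
have n2 : (2 : R) != 0 by [].
rewrite !powRD ?n2 ?(gt_eqF t0) ?implybT//; ring.
Qed.
End Bounds.

(** * The lower bounds on the sharp constant *)

Section LowerBounds.
Variable R : realType.
Implicit Types p n : R.

Lemma le_sharp_constant d p n (c : R) :
  (forall K, admissible d p n K -> c <= K) -> (c%:E <= sharp_constant d p n)%E.
Proof. by move=> cK; apply: le_ereal_inf_tmp => _ [K admK <-]; rewrite lee_fin cK. Qed.

Lemma sqN_gt0 N : (0 < N)%N -> 0 < sqN R N.
Proof. by move=> N0; rewrite exprn_gt0// ltr0n. Qed.

Lemma lower_bound_ge3_le_sharp (d : nat) p n : (3 <= d)%N -> d%:R / 2 < n -> n <= p ->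
  ((lower_bound_ge3 d p n)%:E <= sharp_constant d p n)%E.
Proof.
move=> d3 dn np; apply: le_sharp_constant => K admK.
have n1 : 1 < n.
  by rewrite (le_lt_trans _ dn)// ler_pdivlMr// mul1r ler_nat ltnW.
have n0 : 0 < n + 1 by lra.
have p0 : 0 < p by lra.
set t := (n + 1) / p.
have t0 : 0 < t by rewrite divr_gt0.
have [N [N0 Xlo Xhi]] := exists_frequency p0 n0 np.
set X := sqN R N in Xlo Xhi *.
have X0 : 0 < X by exact: sqN_gt0.
have := admissible_transverse (ltnW d3) N0 d3 admK; rewrite -/X => main.
have sE : p / (2 * (n + 1)) = 1 / (2 * t) by rewrite /t; field; rewrite !gt_eqF.
set F := Phi_ge3 p n; set G := Psi_ge3 p n.
have XF : X <= 1 / (2 * t) * F.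
  rewrite (le_trans Xhi)// sE /F /Phi_ge3.
  by rewrite (_ : 2 * (n + 1) - n = n + 2)//; ring.
have YG : X + 1 <= 1 / (2 * t) * G.
  rewrite (_ : 1 / (2 * t) * G = 1 / (2 * t) * F + 1) ?lerD2r//.
  by rewrite /G /F /Psi_ge3 /Phi_ge3 /t; field; rewrite !gt_eqF.
have s0 : 0 < 1 / (2 * t) by rewrite div1r invr_gt0 mulr_gt0//.
rewrite (mulrDl n 1) (mulrDl p 1) in main.
have D0 : 0 < X `^ (p / 2) * (X + 1) `^ (n / 2 + 1 / 2) +
     X `^ (n / 2) * (X + 1) `^ (p / 2 + 1 / 2).
  by rewrite addr_gt0// mulr_gt0// powR_gt0// addr_gt0.
have DD := @powR_sum_le R _ _ _ _ _ p n (1 / 2) s0 (ltW X0)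
  (ltW (ltr_wpDl (ltW X0) ltr01)) XF YG.
have e0 : 0 <= 1 / 2 :> R by rewrite divr_ge0.
move: DD => /(_ (ltW p0) (ltW (lt_trans ltr01 n1)) e0) DD.
have th0 : 0 <= Theta_ge3 p n by rewrite addr_ge0 ?powR_ge0.
have thE : (2 / t) `^ (p + 0) * Theta_ge3 p n <= (4 * X + 1) `^ p + 1.
  have t2 : 0 < 2 / t by rewrite divr_gt0.
  have q0 : 0 < 1 - (n - 1) / (2 * p).
    by rewrite subr_gt0 ltr_pdivrMr ?mulr_gt0//; lra.
  have r0 : 0 < (n + 1) / (2 * p) by rewrite divr_gt0 ?mulr_gt0.
  rewrite addr0 mulrDr -(powRM _ (ltW t2) (ltW q0)) -(powRM _ (ltW t2) (ltW r0)).
  have -> : 2 / t * ((n + 1) / (2 * p)) = 1 by rewrite /t; field; rewrite !gt_eqF.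
  rewrite powR1 lerD2r; apply: ge0_ler_powR; rewrite ?nnegrE ?(ltW p0)//.
  - by rewrite (ltW (mulr_gt0 t2 q0)).
  - by rewrite addr_ge0// mulr_ge0// ltW.
  have -> : 2 / t * (1 - (n - 1) / (2 * p)) = 4 * ((p - n) / (2 * (n + 1))) + 1.
    by rewrite /t; field; rewrite !gt_eqF.
  by rewrite lerD2r ler_pM2l.
have := lower_bound_rescale (F `^ (p / 2) * G `^ (n / 2 + 1 / 2) +
  F `^ (n / 2) * G `^ (p / 2 + 1 / 2)) p n (1 / 2) 0 t0 th0.
set D' := _ * (_ + _) => resc.
rewrite (_ : lower_bound_ge3 d p n = char_coef R d *
    Num.sqrt (2 * ((2 / t) `^ (p + 0) * Theta_ge3 p n)) / D').
  apply: (ler_pdiv_weaken _ _ _ D0 DD main).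
  - by rewrite mulr_gt0 ?char_coef_gt0// sqrtr_gt0 mulr_gt0// ltr_wpDl ?powR_ge0.
  - by rewrite mulr_ge0 ?sqrtr_ge0// ltW ?char_coef_gt0.
  - rewrite ler_pM2l ?char_coef_gt0// ler_wsqrtr// ler_pM2l//.
rewrite -[RHS]mulrA resc /lower_bound_ge3 /char_coef powRN div1r -/t.
have -> : p + n / 2 + (1 + 0) / 2 + 1 / 2 = p + n / 2 + 1 by field.
have -> : n / 2 + 1 / 2 - 0 / 2 = (n + 1) / 2 by field.
rewrite -[LHS]mulrA; congr (_ * _); rewrite [X in _ = X * _]mulrC -[RHS]mulrA; congr (_ * _).
by rewrite mulrA [X in _ = X / _]mulrC.
Qed.

(** The squared projected amplitude (2 X + 1)^2 / (4 X + 1) lowers the power of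
    4 X + 1 to p - 1 and is responsible for the factor (1 + 3 / p)^2 in
    [Theta_2]: with the lower bound on X = N^2, 2 X + 1 is at least
    (p + 3) / (n + 1). *)
Lemma lower_bound_2_le_sharp p n : 1 < n -> n <= p ->
  ((lower_bound_2 p n)%:E <= sharp_constant 2 p n)%E.
Proof.
move=> n1 np; apply: le_sharp_constant => K admK.
have n0 : 0 < n + 1 by lra.
have p0 : 0 < p by lra.
set t := (n + 1) / p.
have t0 : 0 < t by rewrite divr_gt0.
have np2 : n - 2 <= p by lra.
have [N [N0 Xlo Xhi]] := exists_frequency p0 n0 np2.
set X := sqN R N in Xlo Xhi *.
have X0 : 0 < X by exact: sqN_gt0.
have Y0 : 0 < X + 1 by rewrite addr_gt0.
have := admissible_planar (leqnn 2) N0 admK; rewrite -/X => main.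
have sE : p / (2 * (n + 1)) = 1 / (2 * t) by rewrite /t; field; rewrite !gt_eqF.
set F := Phi_2 p n; set G := Psi_2 p n.
have XF : X <= 1 / (2 * t) * F.
  rewrite (le_trans Xhi)// sE /F /Phi_2.
  by rewrite (_ : 2 * (n + 1) - (n - 2) = n + 4)//; ring.
have YG : X + 1 <= 1 / (2 * t) * G.
  rewrite (_ : 1 / (2 * t) * G = 1 / (2 * t) * F + 1) ?lerD2r//.
  by rewrite /G /F /Psi_2 /Phi_2 /t; field; rewrite !gt_eqF.
have s0 : 0 < 1 / (2 * t) by rewrite div1r invr_gt0 mulr_gt0//.
have DE : Num.sqrt (X + 1) * (X `^ (p / 2) * (X + 1) `^ ((n + 1) / 2) +
     X `^ (n / 2) * (X + 1) `^ ((p + 1) / 2)) =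
   X `^ (p / 2) * (X + 1) `^ (n / 2 + 1) + X `^ (n / 2) * (X + 1) `^ (p / 2 + 1).
  rewrite sqrt_powR_half ?ltW// mulrDr !(mulrCA ((X + 1) `^ _)) -!powRD ?(gt_eqF Y0) ?implybT//.
  by congr (_ * _ `^ _ + _ * _ `^ _); field.
move: main; rewrite -mulrA DE => main.
have D0 : 0 < X `^ (p / 2) * (X + 1) `^ (n / 2 + 1) + X `^ (n / 2) * (X + 1) `^ (p / 2 + 1).
  by rewrite addr_gt0// mulr_gt0// powR_gt0.
have DD := @powR_sum_le R _ _ _ _ _ p n 1 s0 (ltW X0) (ltW Y0) XF YG
  (ltW p0) (ltW (lt_trans ltr01 n1)) ler01.
have q0 : 0 < 1 - (n - 5) / (2 * p) by rewrite subr_gt0 ltr_pdivrMr ?mulr_gt0//; lra.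
have th0 : 0 <= Theta_2 p n by rewrite addr_ge0// mulr_ge0 ?powR_ge0 ?sqr_ge0.
have Z0 : 0 < 4 * X + 1 by rewrite addr_gt0// mulr_gt0.
have thE : (2 / t) `^ (p + 1) * (Theta_2 p n / 4) <=
   (4 * X + 1) `^ p * ((2 * X + 1) ^+ 2 / (4 * X + 1)) + 1.
  have t2 : 0 < 2 / t by rewrite divr_gt0.
  have r0 : 0 < (n + 1) / (2 * p) by rewrite divr_gt0 ?mulr_gt0.
  have -> : (2 / t) `^ (p + 1) * (Theta_2 p n / 4) =
      (2 / t) `^ (p + 1) * ((1 + 3 / p) ^+ 2 / 4 * (1 - (n - 5) / (2 * p)) `^ (p - 1)) +
      (2 / t) `^ (p + 1) * ((n + 1) / (2 * p)) `^ (p + 1).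
    by rewrite /Theta_2 -mulrDr; congr (_ * _); field; rewrite gt_eqF.
  apply: lerD; last first.
    rewrite -(powRM _ (ltW t2) (ltW r0)).
    have -> : 2 / t * ((n + 1) / (2 * p)) = 1 by rewrite /t; field; rewrite !gt_eqF.
    by rewrite powR1.
  rewrite (_ : (4 * X + 1) `^ p * ((2 * X + 1) ^+ 2 / (4 * X + 1)) =
     (4 * X + 1) `^ (p - 1) * (2 * X + 1) ^+ 2); last first.
    by rewrite powRB ?(gt_eqF Z0) ?implybT// powRr1 ?ltW//; field; rewrite gt_eqF.
  rewrite (_ : (2 / t) `^ (p + 1) = (2 / t) `^ (p - 1) * (2 / t) ^+ 2); last first.
    rewrite -powR_mulrn ?ltW// -powRD ?(gt_eqF t2) ?implybT//; congr powR; ring.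
  have -> : (2 / t) `^ (p - 1) * (2 / t) ^+ 2 *
      ((1 + 3 / p) ^+ 2 / 4 * (1 - (n - 5) / (2 * p)) `^ (p - 1)) =
      (2 / t * (1 - (n - 5) / (2 * p))) `^ (p - 1) * ((p + 3) / (n + 1)) ^+ 2.
    rewrite (powRM _ (ltW t2) (ltW q0)).
    have -> : (p + 3) / (n + 1) = (2 / t) / 2 * (1 + 3 / p).
      by rewrite /t; field; rewrite !gt_eqF.
    by field; rewrite !gt_eqF.
  apply: ler_pM; rewrite ?powR_ge0 ?sqr_ge0//.
    have p1 : 0 <= p - 1 by lra.
    apply: ge0_ler_powR; rewrite ?nnegrE ?p1 ?(ltW Z0) ?(ltW (mulr_gt0 t2 q0))//.
    have -> : 2 / t * (1 - (n - 5) / (2 * p)) = 4 * ((p - (n - 2)) / (2 * (n + 1))) + 1.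
      by rewrite /t; field; rewrite !gt_eqF.
    by rewrite lerD2r ler_pM2l.
  have Z2 : 0 <= 2 * X + 1 by rewrite addr_ge0// mulr_ge0// ltW.
  have p3 : 0 <= (p + 3) / (n + 1) by rewrite divr_ge0 ?(ltW n0)// addr_ge0// ltW.
  rewrite lerXn2r//.
  have -> : (p + 3) / (n + 1) = 2 * ((p - (n - 2)) / (2 * (n + 1))) + 1.
    by field; rewrite !gt_eqF.
  by rewrite lerD2r ler_pM2l.
have th40 : 0 <= Theta_2 p n / 4 by rewrite divr_ge0.
have := lower_bound_rescale (F `^ (p / 2) * G `^ (n / 2 + 1) +
  F `^ (n / 2) * G `^ (p / 2 + 1)) p n 1 1 t0 th40.
set D' := _ * (_ + _) => resc.
rewrite (_ : lower_bound_2 p n = char_coef R 2 *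
    Num.sqrt (2 * ((2 / t) `^ (p + 1) * (Theta_2 p n / 4))) / D').
  apply: (ler_pdiv_weaken _ _ _ D0 DD main).
  - rewrite mulr_gt0 ?char_coef_gt0// sqrtr_gt0 mulr_gt0// ltr_wpDl//.
    by rewrite mulr_ge0 ?powR_ge0// divr_ge0 ?sqr_ge0 ?ltW.
  - by rewrite mulr_ge0 ?sqrtr_ge0// ltW ?char_coef_gt0.
  - rewrite ler_pM2l ?char_coef_gt0// ler_wsqrtr// ler_pM2l//.
rewrite -[RHS]mulrA resc.
have -> : p + n / 2 + (1 + 1) / 2 + 1 = (p + n / 2) + 2%:R by field.
have -> : n / 2 + 1 - 1 / 2 = (n + 1) / 2 by field.
rewrite /lower_bound_2 /char_coef divff// powRN powRr1 ?mulr_ge0 ?pi_ge0// -/t.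
have -> : (Theta_2 p n / 4) `^ (1 / 2) = Theta_2 p n `^ (1 / 2) / 2.
  rewrite powRM ?invr_ge0// (_ : 4^-1 = (2^-1) ^+ 2 :> R); last by field.
  rewrite -powR_mulrn// -powRrM (_ : 2%:R * (1 / 2) = 1 :> R); last by field.
  by rewrite powRr1.
have -> : 2 `^ (p + n / 2 + 2%:R) = 2 `^ (p + n / 2) * 4 :> R.
  by rewrite powRD ?pnatr_eq0 ?implybT// powR_mulrn// -natrX.
rewrite -/F -/G; set Ds := F `^ _ * _ + _; move: Ds^-1 => Di.
move: pi (lt0r_neq0 (pi_gt0 R)) => y y0; by field.
Qed.
End LowerBounds.

(** * Second-order expansion of the logarithm *)

Section RealLimits.
Variable R : realType.
Implicit Types (f g h : R -> R).

Lemma cvgy_eq f g (M l : R) : (forall p, M < p -> f p = g p) ->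
  g p @[p --> +oo] --> l -> f p @[p --> +oo] --> l.
Proof.
move=> fg; apply: cvg_trans; apply: near_eq_cvg.
near=> p; apply/esym/fg; near: p; apply: nbhs_pinfty_gt; exact: num_real.
Unshelve. all: by end_near. Qed.

Lemma cvgy_inv : p^-1 @[p --> +oo] --> (0 : R).
Proof.
apply/cvgrPdist_lt => e e0; near=> p.
have p0 : 0 < p by near: p; apply: nbhs_pinfty_gt.
rewrite sub0r normrN gtr0_norm ?invr_gt0// invf_plt ?posrE//.
by near: p; apply: nbhs_pinfty_gt; rewrite num_real.
Unshelve. all: by end_near. Qed.

Lemma cvgy_div (c : R) : c / p @[p --> +oo] --> (0 : R).
Proof. by rewrite -(mulr0 c); apply: cvgMr; exact: cvgy_inv. Qed.

(** Used to compare ln (1 + x) with its Taylor polynomials: the derivative of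
    the difference is a nonnegative rational function. *)
Lemma ge0_of_derive f g (x : R) : 0 <= x -> f 0 = 0 ->
  (forall t : R, 0 <= t -> is_derive t (1 : R) f (g t)) ->
  (forall t : R, 0 <= t -> 0 <= g t) -> 0 <= f x.
Proof.
move=> x0 f0 df g0; rewrite -f0.
apply: (@ger0_derive1_ndecr R f 0 x); rewrite ?lexx//.
- by move=> t; rewrite in_itv/= => /andP[/ltW/df[]].
- by move=> t; rewrite in_itv/= => /andP[/ltW t0 _]; have [_ dt] := df t t0; rewrite derive1E dt g0.
- apply: derivable_within_continuous => t; rewrite in_itv/= => /andP[t0 _].
  by case: (df _ t0).
Qed.

Lemma is_derive_ln1D (t : R) : 0 <= t ->
  is_derive t (1 : R) (fun y : R => ln (1 + y)) (1 + t)^-1.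
Proof.
move=> t0; have t1 : 0 < 1 + t by rewrite ltr_pwDl.
have dln := is_derive1_ln t1.
have dl : is_derive t (1 : R) (fun y : R => 1 + y) 1.
  by apply: is_derive_eq; rewrite add0r mulr1.
have := @is_derive1_comp _ (@ln R) (fun y : R => 1 + y) t _ _ dln dl.
by rewrite mulr1.
Qed.

Lemma ln1D_ge (x : R) : 0 <= x -> x - x ^+ 2 / 2 <= ln (1 + x).
Proof.
move=> x0; rewrite -subr_ge0.
apply: (@ge0_of_derive (fun t => ln (1 + t) - (t - t ^+ 2 / 2))
  (fun t => (1 + t)^-1 - (1 - t))) => //.
- by rewrite addr0 ln1 expr0n/= mul0r !subr0.
- move=> t t0; have dl := is_derive_ln1D t0.
  apply: is_deriveB; apply: is_derive_eq; rewrite /GRing.scale/=; by field.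
- move=> t t0; have t1 : 0 < 1 + t by rewrite ltr_pwDl.
  rewrite (_ : _ - _ = t ^+ 2 / (1 + t)); first by rewrite divr_ge0 ?sqr_ge0 ?ltW.
  by field; rewrite gt_eqF.
Qed.

Lemma ln1D_le (x : R) : 0 <= x -> ln (1 + x) <= x - x ^+ 2 / 2 + x ^+ 3 / 3.
Proof.
move=> x0; rewrite -subr_ge0.
apply: (@ge0_of_derive (fun t => t - t ^+ 2 / 2 + t ^+ 3 / 3 - ln (1 + t))
  (fun t => (1 - t + t ^+ 2) - (1 + t)^-1)) => //.
- by rewrite addr0 ln1 !expr0n/= !mul0r subr0 addr0 subr0.
- move=> t t0; have dl := is_derive_ln1D t0.
  apply: is_deriveB; apply: is_derive_eq; rewrite /GRing.scale/=; by field.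
- move=> t t0; have t1 : 0 < 1 + t by rewrite ltr_pwDl.
  rewrite (_ : _ - _ = t ^+ 3 / (1 + t)); first by rewrite (divr_ge0 (exprn_ge0 _ t0) (ltW t1)).
  by field; rewrite gt_eqF.
Qed.

(** The lower bound is the upper one at - x / (1 + x), since 1 / (1 + x) is
    1 - x / (1 + x). *)
Lemma ln1D_bounds (x : R) : -1 < x -> x / (1 + x) <= ln (1 + x) <= x.
Proof.
move=> x1; have x0 : 0 < 1 + x by lra.
rewrite le_ln1Dx// andbT -[ln _]opprK -lnV ?posrE// lerNr.
rewrite [X in ln X](_ : _ = 1 + (- (x / (1 + x)))); last by field; rewrite gt_eqF.
apply: le_ln1Dx; rewrite ltrN2 ltr_pdivrMr//; lra.
Qed.

Lemma cvgy_mul_ln1D (c : R) : p * ln (1 + c / p) @[p --> +oo] --> c.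
Proof.
apply: (@squeeze_cvgr _ _ _ _ (fun p => c / (1 + c / p)) (fun=> c)); last exact: cvg_cst.
  near=> p.
  have p0 : 0 < p by near: p; apply: nbhs_pinfty_gt.
  have pc : - c < p by near: p; apply: nbhs_pinfty_gt; exact: num_real.
  have c1 : -1 < c / p by rewrite ltr_pdivlMr// mulN1r; lra.
  have /andP[lo hi] := ln1D_bounds c1.
  have -> : c / (1 + c / p) = p * (c / p / (1 + c / p)).
    by rewrite mulrA [p * (c / p)]mulrC divfK ?(gt_eqF p0)//.
  rewrite ler_pM2l// lo /=.
  by rewrite -ler_pdivlMl// [p^-1 * c]mulrC.
suff: c / (1 + c / p) @[p --> +oo] --> c / (1 + 0) by rewrite addr0 divr1.
apply: cvgMr; apply: cvgV; first by rewrite addr0 oner_neq0.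
by apply: cvgD; [exact: cvg_cst|exact: cvgy_div].
Unshelve. all: by end_near. Qed.

Lemma cvgy_sqrt_near1 (al : R) : Num.sqrt (1 - al / p) @[p --> +oo] --> (1 : R).
Proof.
suff: Num.sqrt (1 - al / p) @[p --> +oo] --> (Num.sqrt 1 : R) by rewrite sqrtr1.
apply: (@continuous_cvg _ _ _ _ _ (fun p => 1 - al / p) Num.sqrt).
  exact: sqrt_continuous.
suff: 1 - al / p @[p --> +oo] --> (1 - 0 : R) by rewrite subr0.
by apply: cvgB; [exact: cvg_cst|exact: cvgy_div].
Qed.

Lemma cvgy_sqrt_div (c : R) : Num.sqrt (c / p) @[p --> +oo] --> (0 : R).
Proof.
suff: Num.sqrt (c / p) @[p --> +oo] --> (Num.sqrt 0 : R) by rewrite sqrtr0.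
apply: (@continuous_cvg _ _ _ _ _ (fun p => c / p) Num.sqrt).
  exact: sqrt_continuous.
exact: cvgy_div.
Qed.

Lemma cvgy_base (al be c : R) :
  1 + 2 * Num.sqrt (1 - al / p) * Num.sqrt (c / p) + be / p @[p --> +oo] --> (1 : R).
Proof.
suff: 1 + 2 * Num.sqrt (1 - al / p) * Num.sqrt (c / p) + be / p @[p --> +oo] -->
    (1 + 2 * 1 * 0 + 0 : R) by rewrite mulr0 !addr0.
apply: cvgD; last exact: cvgy_div.
apply: cvgD; first exact: cvg_cst.
apply: cvgM; last exact: cvgy_sqrt_div.
by apply: cvgM; [exact: cvg_cst|exact: cvgy_sqrt_near1].
Qed.

(** Write s and q for the two square roots and delta = 2 s q + be / p, so that
    sqrt (c p) = p q and p delta^2 = H is bounded, with limit 4 c.  The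
    first-order term p delta / 2 exceeds p q by be / 2 + p q (s - 1), which
    tends to be / 2; the second-order term is - H / 4; the third-order one,
    H delta / 6, is negligible. *)
Lemma cvgy_log_base (al be c : R) : 0 < c -> 0 < be ->
  p / 2 * ln (1 + 2 * Num.sqrt (1 - al / p) * Num.sqrt (c / p) + be / p)
    - Num.sqrt (c * p) @[p --> +oo] --> be / 2 - c.
Proof.
move=> c0 be0.
pose s (p : R) := Num.sqrt (1 - al / p).
pose q (p : R) := Num.sqrt (c / p).
pose delta (p : R) := 2 * s p * q p + be / p.
pose H (p : R) := 4 * (s p ^+ 2 * c + s p * q p * be + be ^+ 2 / 4 / p).
pose E (p : R) := - al * q p / (1 + s p) + be / 2 - H p / 4.
have cs : s p @[p --> +oo] --> (1 : R) by exact: cvgy_sqrt_near1.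
have cq : q p @[p --> +oo] --> (0 : R) by exact: cvgy_sqrt_div.
have cdelta : delta p @[p --> +oo] --> (0 : R).
  suff: delta p @[p --> +oo] --> (2 * 1 * 0 + 0 : R) by rewrite mulr0 addr0.
  apply: cvgD; last exact: cvgy_div.
  by apply: cvgM => //; apply: cvgM => //; exact: cvg_cst.
have cH : H p @[p --> +oo] --> 4 * c.
  suff: H p @[p --> +oo] --> 4 * (1 ^+ 2 * c + 1 * 0 * be + 0).
    by rewrite expr1n mul1r mulr0 mul0r !addr0.
  apply: cvgMr; apply: cvgD; last exact: cvgy_div.
  apply: cvgD; first by apply: cvgMl; rewrite expr2; under eq_fun do rewrite expr2; exact: cvgM.
  by apply: cvgMl; exact: cvgM.
have cE : E p @[p --> +oo] --> be / 2 - c.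
  suff: E p @[p --> +oo] --> - al * 0 / (1 + 1) + be / 2 - 4 * c / 4.
    by rewrite mulr0 mul0r add0r [4 * c]mulrC mulfK.
  apply: cvgB; last exact: cvgMl.
  apply: cvgD; last exact: cvg_cst.
  apply: cvgM; first exact: cvgMr.
  by apply: cvgV => //; apply: cvgD => //; exact: cvg_cst.
apply: (@squeeze_cvgr _ _ _ _ E (fun p => E p + H p * delta p / 6)) => //; last first.
  suff: E p + H p * delta p / 6 @[p --> +oo] --> be / 2 - c + 4 * c * 0 / 6.
    by rewrite mulr0 mul0r addr0.
  by apply: cvgD => //; apply: cvgMl; exact: cvgM.
near=> p.
have p0 : 0 < p by near: p; apply: nbhs_pinfty_gt.
have pal : al < p by near: p; apply: nbhs_pinfty_gt; exact: num_real.
have s0 : 0 <= s p by exact: sqrtr_ge0.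
have q0 : 0 <= q p by exact: sqrtr_ge0.
have s2 : s p ^+ 2 = 1 - al / p.
  by rewrite sqr_sqrtr// subr_ge0 ler_pdivrMr// mul1r ltW.
have q2 : q p ^+ 2 = c / p by rewrite sqr_sqrtr// divr_ge0 ?ltW.
have pq : Num.sqrt (c * p) = p * q p.
  rewrite -{2}(gtr0_norm p0) -sqrtr_sqr -sqrtrM ?sqr_ge0//; congr Num.sqrt.
  by field; rewrite gt_eqF.
have d0 : 0 <= delta p by rewrite addr_ge0// ?mulr_ge0// ?invr_ge0 ltW.
have Hd : p * delta p ^+ 2 = H p.
  rewrite /H /delta.
  have -> : (2 * s p * q p + be / p) ^+ 2 =
     4 * (s p ^+ 2 * q p ^+ 2) + 4 * (s p * q p) * (be / p) + (be / p) ^+ 2 by ring.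
  by rewrite q2; field; rewrite gt_eqF.
have Ed : p / 2 * (delta p - delta p ^+ 2 / 2) - p * q p = E p.
  have -> : p / 2 * (delta p - delta p ^+ 2 / 2) - p * q p =
     p * q p * (s p - 1) + be / 2 - p * delta p ^+ 2 / 4.
    by rewrite {1}/delta; field; rewrite gt_eqF.
  rewrite Hd /E; congr (_ + _ - _).
  have s1 : 1 + s p != 0 by rewrite gt_eqF// ltr_pwDl.
(* p q (s - 1) = - al q / (1 + s), from p (s^2 - 1) = - al *)
  have -> : al = p * (1 - s p ^+ 2) by rewrite s2; field; rewrite gt_eqF.
  by field.
rewrite pq -addrA -/(delta p) -Ed.
have p2 : 0 < p / 2 by rewrite divr_gt0.
apply/andP; split; first by rewrite lerD2r ler_pM2l// ln1D_ge.
rewrite addrAC lerD2r -Hd.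
have -> : p / 2 * (delta p - delta p ^+ 2 / 2) + p * delta p ^+ 2 * delta p / 6 =
   p / 2 * (delta p - delta p ^+ 2 / 2 + delta p ^+ 3 / 3) by field.
by rewrite ler_pM2l// ln1D_le.
Unshelve. all: by end_near. Qed.

End RealLimits.

(** * Asymptotics of the lower bounds *)

Section Asymptotics.
Variable R : realType.
Implicit Types (f g h : R -> R) (d : nat) (n : R).

Lemma cvgy_powR f (l a : R) : 0 < l -> f p @[p --> +oo] --> l ->
  f p `^ a @[p --> +oo] --> l `^ a.
Proof.
move=> l0 fl; rewrite /powR (gt_eqF l0).
suff lim_exp : expR (a * ln (f p)) @[p --> +oo] --> expR (a * ln l).
  move: lim_exp; apply: cvg_trans; apply: near_eq_cvg; near=> p.
  have fp : 0 < f p by near: p; exact: (cvgr_gt l).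
  by rewrite gt_eqF.
apply: (@continuous_cvg _ _ _ _ _ (fun p => a * ln (f p)) (@expR R)).
  exact: continuous_expR.
apply: cvgMr; apply: (@continuous_cvg _ _ _ _ _ f (@ln R)) => //.
exact: continuous_ln.
Unshelve. all: by end_near. Qed.

Lemma cvgy_expR f (l : R) : f p @[p --> +oo] --> l ->
  expR (f p) @[p --> +oo] --> expR l.
Proof.
by move=> fl; apply: (@continuous_cvg _ _ _ _ _ f (@expR R)) => //; exact: continuous_expR.
Qed.

Lemma cvgy_1D_powR (c : R) : (1 + c / p) `^ p @[p --> +oo] --> expR c.
Proof.
apply: (@cvgy_eq _ _ (fun p => expR (p * ln (1 + c / p))) `|c|); last first.
  exact/cvgy_expR/cvgy_mul_ln1D.
move=> p pc; have p0 : 0 < p by rewrite (le_lt_trans _ pc).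
have b0 : 0 < 1 + c / p.
  rewrite -ltrBlDl sub0r ltr_pdivlMr// mulN1r ltrNl (le_lt_trans _ pc)//.
  by rewrite -normrN ler_norm.
by rewrite /powR (gt_eqF b0).
Qed.

(** For p large the base is at most 1 and the exponent at least 1, so the power
    is at most c / p. *)
Lemma cvgy_div_powR0 (c e : R) : 0 < c -> 0 <= e ->
  (c / p) `^ (p + e) @[p --> +oo] --> (0 : R).
Proof.
move=> c0 e0; apply: (@squeeze_cvgr _ _ _ _ (fun=> 0) (fun p => c / p)).
- near=> p.
  have pc : c < p by near: p; apply: nbhs_pinfty_gt; exact: num_real.
  have p1 : 1 < p by near: p; apply: nbhs_pinfty_gt; exact: num_real.
  have p0 : 0 < p by rewrite (lt_trans _ p1).
  rewrite powR_ge0 ge1r_powR//; last by rewrite (le_trans (ltW p1))// lerDl.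
  by rewrite divr_gt0// ler_pdivrMr// mul1r ltW.
- exact: cvg_cst.
- exact: cvgy_div.
Unshelve. all: by end_near. Qed.

Lemma cvgy_Theta_ge3 n : 1 < n -> Theta_ge3 p n @[p --> +oo] --> expR (- ((n - 1) / 2)).
Proof.
move=> n1.
apply: (@cvgy_eq _ _ (fun p => (1 + (- ((n - 1) / 2)) / p) `^ p + ((n + 1) / 2 / p) `^ (p + 0)) 0).
  move=> p p0; rewrite /Theta_ge3 addr0.
  by congr (_ `^ _ + _ `^ _); field; rewrite gt_eqF.
rewrite -[X in _ --> X]addr0; apply: cvgD; first exact: cvgy_1D_powR.
by apply: cvgy_div_powR0 => //; rewrite divr_gt0//; lra.
Qed.

Lemma cvgy_Theta_2 n : 1 < n -> Theta_2 p n @[p --> +oo] --> expR (- ((n - 5) / 2)).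
Proof.
move=> n1.
apply: (@cvgy_eq _ _ (fun p => (1 + 3 / p) * (1 + 3 / p) * ((1 + (- ((n - 5) / 2)) / p) `^ p
   * (1 + (- ((n - 5) / 2)) / p)^-1) + 4 * ((n + 1) / 2 / p) `^ (p + 1)) `|(n - 5) / 2|).
  move=> p pc; have p0 : 0 < p by rewrite (le_lt_trans _ pc).
  have b0 : 0 < 1 + - ((n - 5) / 2) / p.
    by rewrite mulNr subr_gt0 ltr_pdivrMr// mul1r (le_lt_trans _ pc)// ler_norm.
  rewrite /Theta_2 expr2.
  have -> : 1 - (n - 5) / (2 * p) = 1 + - ((n - 5) / 2) / p by field; rewrite gt_eqF.
  rewrite powRB ?(gt_eqF b0) ?implybT// powRr1 ?(ltW b0)//.
  by congr (_ + 4 * _ `^ _); field; rewrite gt_eqF.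
have inv1 (c : R) : 1 + c / p @[p --> +oo] --> (1 : R).
  rewrite -[X in _ --> X]addr0; apply: cvgD; [exact: cvg_cst|exact: cvgy_div].
suff : (1 + 3 / p) * (1 + 3 / p) * ((1 + (- ((n - 5) / 2)) / p) `^ p
   * (1 + (- ((n - 5) / 2)) / p)^-1) + 4 * ((n + 1) / 2 / p) `^ (p + 1) @[p --> +oo] -->
  (1 * 1 * (expR (- ((n - 5) / 2)) * 1^-1) + 4 * 0 : R).
  by rewrite invr1 !mulr1 mul1r mulr0 addr0.
apply: cvgD; last first.
  by apply: cvgMr; apply: cvgy_div_powR0 => //; rewrite divr_gt0//; lra.
apply: cvgM; first exact: cvgM.
by apply: cvgM; [exact: cvgy_1D_powR|exact: cvgV].
Qed.

(** Dividing the denominator by e^(sqrt (2 (n+1) p)) isolates the factors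
    Phi^(p/2) and Psi^(p/2), which tend to e^phi and e^(phi + n + 1) after this
    division; the remaining powers have fixed exponents and bases tending
    to 1. *)
Lemma cvgy_ratio (Theta Phi Psi : R -> R) (n th phi e : R) :
  Theta p @[p --> +oo] --> expR th ->
  Phi p @[p --> +oo] --> (1 : R) -> Psi p @[p --> +oo] --> (1 : R) ->
  p / 2 * ln (Phi p) - Num.sqrt (2 * (n + 1) * p) @[p --> +oo] --> phi ->
  p / 2 * ln (Psi p) - Num.sqrt (2 * (n + 1) * p) @[p --> +oo] -->
    phi + (n + 1) ->
  Theta p `^ (1 / 2) * (expR (Num.sqrt (2 * (n + 1) * p)) /
    (Phi p `^ (p / 2) * Psi p `^ (n / 2 + e) +
     Phi p `^ (n / 2) * Psi p `^ (p / 2 + e))) @[p --> +oo] -->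
  expR (th / 2 - phi) / (1 + expR (n + 1)).
Proof.
move=> cTheta cPhi cPsi lPhi lPsi.
have -> : expR (th / 2 - phi) / (1 + expR (n + 1)) =
  expR th `^ (1 / 2) / (expR phi * 1 `^ (n / 2 + e) +
    1 `^ (n / 2) * (expR (phi + (n + 1)) * 1 `^ e)).
  rewrite !powR1 !mulr1 !mul1r -expRM expRB (expRD phi).
  by rewrite [X in _ = _ / X](_ : _ = expR phi * (1 + expR (n + 1))) ?invfM ?mulrA//; ring.
pose root p : R := Num.sqrt (2 * (n + 1) * p).
pose A p := expR (p / 2 * ln (Phi p) - root p).
pose B p := expR (p / 2 * ln (Psi p) - root p).
suff lim_exp : Theta p `^ (1 / 2) / (A p * Psi p `^ (n / 2 + e) +
    Phi p `^ (n / 2) * (B p * Psi p `^ e)) @[p --> +oo] -->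
    expR th `^ (1 / 2) / (expR phi * 1 `^ (n / 2 + e) +
    1 `^ (n / 2) * (expR (phi + (n + 1)) * 1 `^ e)).
  move: lim_exp; apply: cvg_trans; apply: near_eq_cvg; near=> p.
  have F0 : 0 < Phi p by near: p; exact: (cvgr_gt 1).
  have G0 : 0 < Psi p by near: p; exact: (cvgr_gt 1).
  congr (_ * _); rewrite -[RHS]invrK invfM invrK; congr _^-1.
  rewrite /A /B /root !expRB (@powRD _ (Psi p) (p / 2) e) ?(gt_eqF G0) ?implybT//.
  rewrite [Phi p `^ (p / 2)]/powR [Psi p `^ (p / 2)]/powR (gt_eqF F0) (gt_eqF G0).
  by field; rewrite gt_eqF ?expR_gt0.
apply: cvgM; first by apply: cvgy_powR => //; exact: expR_gt0.
apply: cvgV.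
  by rewrite !powR1 !mulr1 mul1r gt_eqF// addr_gt0 ?expR_gt0.
apply: cvgD; apply: cvgM.
- exact: cvgy_expR.
- exact: cvgy_powR.
- exact: cvgy_powR.
- by apply: cvgM; [exact: cvgy_expR|exact: cvgy_powR].
Unshelve. all: by end_near. Qed.

(** The form common to both lower bounds.  The relation between th and phi says
    that the exponential constants of the bound and of its equivalent agree. *)
Lemma cvgy_lower_bound_ratio (Theta Phi Psi K : R -> R) d n (th phi e : R) :
  th / 2 - phi = 5 * (n + 1) / 4 -> 0 < n + 1 ->
  Theta p @[p --> +oo] --> expR th ->
  Phi p @[p --> +oo] --> (1 : R) -> Psi p @[p --> +oo] --> (1 : R) ->
  p / 2 * ln (Phi p) - Num.sqrt (2 * (n + 1) * p) @[p --> +oo] --> phi ->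
  p / 2 * ln (Psi p) - Num.sqrt (2 * (n + 1) * p) @[p --> +oo] --> phi + (n + 1) ->
  (forall p : R, 0 < p -> K p = 2 / (2 * pi) `^ (d%:R / 2) * ((n + 1) / p) `^ ((n + 1) / 2) *
    (Theta p `^ (1 / 2) * 2 `^ (p + n / 2) /
     (Phi p `^ (p / 2) * Psi p `^ (n / 2 + e) +
      Phi p `^ (n / 2) * Psi p `^ (p / 2 + e)))) ->
  K p / lower_bound_asymptotics d p n @[p --> +oo] --> (1 : R).
Proof.
move=> thphi n0 cT cF cG lF lG KE.
have lim := cvgy_ratio e cT cF cG lF lG.
have E0 : expR (5 * (n + 1) / 4) != 0 :> R by rewrite gt_eqF ?expR_gt0.
have E1 : expR (n + 1) + 1 != 0 :> R by rewrite gt_eqF// addr_gt0 ?expR_gt0.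
have one : expR (th / 2 - phi) / (1 + expR (n + 1)) *
    ((expR (n + 1) + 1) / expR (5 * (n + 1) / 4)) = 1.
  by rewrite thphi (addrC 1); field; rewrite E0 E1.
have limC := cvgM lim (cvg_cst ((expR (n + 1) + 1) / expR (5 * (n + 1) / 4))).
rewrite one in limC; apply: (@cvgy_eq _ _ (fun p => Theta p `^ (1 / 2) *
  (expR (Num.sqrt (2 * (n + 1) * p)) /
   (Phi p `^ (p / 2) * Psi p `^ (n / 2 + e) + Phi p `^ (n / 2) * Psi p `^ (p / 2 + e))) *
  ((expR (n + 1) + 1) / expR (5 * (n + 1) / 4))) 0); last exact: limC.
move=> p p0; rewrite KE// /lower_bound_asymptotics /=.
have a0 : (2 * pi) `^ (d%:R / 2) != 0 :> R by rewrite gt_eqF// powR_gt0// mulr_gt0// pi_gt0.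
have b0 : ((n + 1) / p) `^ ((n + 1) / 2) != 0 by rewrite gt_eqF// powR_gt0// divr_gt0.
have c0 : 2 `^ (p + n / 2) != 0 :> R by rewrite gt_eqF// powR_gt0.
have e0 : expR (Num.sqrt (2 * (n + 1) * p)) != 0 :> R by rewrite gt_eqF ?expR_gt0.
set Ds := Phi p `^ (p / 2) * _ + _.
move: (Theta p `^ (1 / 2)) (Ds^-1) => x y.
by field; rewrite a0 b0 c0 e0 E0 E1.
Qed.

(** ln p = 2 ln (sqrt p) is at most 2 sqrt p. *)
Lemma cvgy_ln_div : ln p / p @[p --> +oo] --> (0 : R).
Proof.
apply: (@squeeze_cvgr _ _ _ _ (fun=> 0) (fun p => 2 * Num.sqrt (1 / p))).
- near=> p.
  have p1 : 1 < p by near: p; apply: nbhs_pinfty_gt.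
  have p0 : 0 < p by rewrite (lt_trans _ p1).
  have s0 : 0 < Num.sqrt p by rewrite sqrtr_gt0.
  rewrite (divr_ge0 (ln_ge0 (ltW p1)) (ltW p0)) /= ler_pdivrMr//.
  have -> : ln p = 2 * ln (Num.sqrt p).
    by rewrite mulr_natl -lnXn// sqr_sqrtr// ltW.
  rewrite -mulrA ler_pM2l//.
  suff -> : Num.sqrt (1 / p) * p = Num.sqrt p by rewrite ltW// ln_sublinear.
  rewrite -{2}(gtr0_norm p0) -sqrtr_sqr -sqrtrM ?(divr_ge0 ler01 (ltW p0))//; congr Num.sqrt.
  by field; rewrite gt_eqF.
- exact: cvg_cst.
- rewrite -[X in _ --> X](mulr0 2); apply: cvgMr; exact: cvgy_sqrt_div.
Unshelve. all: by end_near. Qed.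

(** ln (K p) / p is the logarithm of the ratio, which tends to 0 and is divided
    by p, plus the logarithm of the equivalent divided by p, where only the
    factor 2^p survives. *)
Lemma cvgy_root (K : R -> R) d n : 0 < n + 1 ->
  K p / lower_bound_asymptotics d p n @[p --> +oo] --> (1 : R) ->
  K p `^ (1 / p) @[p --> +oo] --> (2 : R).
Proof.
move=> n0 lim.
pose C : R := 2 / (2 * pi) `^ (d%:R / 2) * (expR (5 * (n + 1) / 4) / (expR (n + 1) + 1)).
have C0 : 0 < C.
  apply: mulr_gt0; apply: divr_gt0; rewrite ?expR_gt0//.
  by rewrite powR_gt0// mulr_gt0// pi_gt0.
pose r p := K p / lower_bound_asymptotics d p n.
pose G (p : R) := ln (r p) / p + (ln C / p + ((n + 1) / 2 * (ln (n + 1) / p - ln p / p)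
  + (ln 2 + n / 2 * ln 2 / p - Num.sqrt (2 * (n + 1) / p)))).
have cG : G p @[p --> +oo] --> ln 2.
  have -> : ln 2 = ln 1 * 0 + (0 + ((n + 1) / 2 * (0 - 0) + (ln 2 + 0 - 0))) :> R.
    by rewrite mulr0 !subr0 mulr0 addr0 !add0r.
  apply: cvgD.
    apply: cvgM; last exact: cvgy_inv.
    apply: (@continuous_cvg _ _ _ _ _ r (@ln R)) => //; exact: continuous_ln.
  apply: cvgD; first exact: cvgy_div.
  apply: cvgD.
    by apply: cvgMr; apply: cvgB; [exact: cvgy_div|exact: cvgy_ln_div].
  apply: cvgB; last exact: cvgy_sqrt_div.
  by apply: cvgD; [exact: cvg_cst|exact: cvgy_div].
have := cvgy_expR cG; rewrite lnK ?posrE//.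
apply: cvg_trans; apply: near_eq_cvg; near=> p.
have p0 : 0 < p by near: p; apply: nbhs_pinfty_gt.
have r0 : 0 < r p by near: p; exact: (cvgr_gt 1).
have t0 : 0 < (n + 1) / p by rewrite divr_gt0.
have asymE : lower_bound_asymptotics d p n = C * ((n + 1) / p) `^ ((n + 1) / 2) *
  (2 `^ (p + n / 2) / expR (Num.sqrt (2 * (n + 1) * p))) by [].
have A1 : 0 < ((n + 1) / p) `^ ((n + 1) / 2) by rewrite powR_gt0.
have A2 : 0 < 2 `^ (p + n / 2) :> R by rewrite powR_gt0.
have A3 := expR_gt0 (Num.sqrt (2 * (n + 1) * p)).
have as0 : 0 < lower_bound_asymptotics d p n.
  by rewrite asymE; apply: mulr_gt0; [exact: mulr_gt0|exact: divr_gt0].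
have KE : K p = r p * lower_bound_asymptotics d p n by rewrite /r divfK// gt_eqF.
have K0 : 0 < K p by rewrite KE mulr_gt0.
rewrite /powR (gt_eqF K0); congr expR.
have L1 := lnM r0 as0; rewrite KE L1 asymE.
rewrite lnM ?posrE ?(mulr_gt0 C0 A1) ?(divr_gt0 A2 A3)// lnM ?posrE//.
rewrite ln_div ?posrE// !ln_powR expRK ln_div ?posrE// /G.
have -> : Num.sqrt (2 * (n + 1) * p) = p * Num.sqrt (2 * (n + 1) / p).
  rewrite -{2}(gtr0_norm p0) -sqrtr_sqr -sqrtrM ?sqr_ge0//; congr Num.sqrt.
  by field; rewrite gt_eqF.
by field; rewrite gt_eqF.
Unshelve. all: by end_near. Qed.

Lemma cvgy_lower_bound d n : (2 <= d)%N -> d%:R / 2 < n ->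
  lower_bound d p n / lower_bound_asymptotics d p n @[p --> +oo] --> (1 : R).
Proof.
move=> d2 dn.
have n1 : 1 < n by rewrite (le_lt_trans _ dn)// ler_pdivlMr// mul1r ler_nat.
have n0 : 0 < n + 1 by lra.
have c0 : 0 < 2 * (n + 1) by rewrite mulr_gt0.
rewrite /lower_bound; case: eqP => [d_eq|_].
  refine (@cvgy_lower_bound_ratio (fun p => Theta_2 p n) (fun p => Phi_2 p n)
    (fun p => Psi_2 p n) (fun p => lower_bound_2 p n) d n
    (- ((n - 5) / 2)) ((n + 4) / 2 - 2 * (n + 1)) 1 _ n0 _ _ _ _ _ _).
  - by field.
  - exact: cvgy_Theta_2.
  - exact: cvgy_base.
  - exact: cvgy_base.
  - by apply: cvgy_log_base => //; lra.
  - have -> : (n + 4) / 2 - 2 * (n + 1) + (n + 1) = 3 * (n + 2) / 2 - 2 * (n + 1) by field.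
    by apply: cvgy_log_base => //; lra.
  move=> p p0; rewrite /lower_bound_2 d_eq divff// powRr1 ?mulr_ge0 ?pi_ge0//.
  congr (_ * _ * _).
  by rewrite invfM mulrA divff// .
refine (@cvgy_lower_bound_ratio (fun p => Theta_ge3 p n) (fun p => Phi_ge3 p n)
    (fun p => Psi_ge3 p n) (fun p => lower_bound_ge3 d p n) d n
    (- ((n - 1) / 2)) ((n + 2) / 2 - 2 * (n + 1)) (1 / 2) _ n0 _ _ _ _ _ _).
- by field.
- exact: cvgy_Theta_ge3.
- exact: cvgy_base.
- exact: cvgy_base.
- by apply: cvgy_log_base => //; lra.
- have -> : (n + 2) / 2 - 2 * (n + 1) + (n + 1) = (3 * n + 4) / 2 - 2 * (n + 1) by field.
  by apply: cvgy_log_base => //; lra.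
move=> p p0; rewrite /lower_bound_ge3.
have -> : 2 `^ (p + n / 2 + 1) = 2 * 2 `^ (p + n / 2) :> R.
  by rewrite powRD ?pnatr_eq0 ?implybT// powRr1// mulrC.
move: (_ `^ (d%:R / 2)) => a; set Ds := _ + _ `^ _ * _; move: (Ds^-1) (a^-1) => y x.
by ring.
Qed.
End Asymptotics.

Theorem proposition9p5 (R : realType) :
  (forall (d : nat) (p n : R), (3 <= d)%N -> d%:R / 2 < n -> n <= p ->
     ((lower_bound_ge3 d p n)%:E <= sharp_constant d p n)%E) /\
  (forall p n : R, 1 < n -> n <= p ->
     ((lower_bound_2 p n)%:E <= sharp_constant 2 p n)%E) /\
  (forall (d : nat) (n : R), (2 <= d)%N -> d%:R / 2 < n ->
     (lower_bound d p n / lower_bound_asymptotics d p n @[p --> +oo] --> (1 : R)) /\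
     (lower_bound d p n `^ (1 / p) @[p --> +oo] --> (2 : R))).
Proof.
split; [exact: lower_bound_ge3_le_sharp|split; [exact: lower_bound_2_le_sharp|]].
move=> d n d2 dn; have lim := cvgy_lower_bound d2 dn; split=> //.
apply: (cvgy_root _ lim).
by rewrite ltr_pwDr// ltW// (le_lt_trans _ dn)// divr_ge0.
Qed.
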